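(* Let $H$ be a Hilbert space, $\mu$ a finite measure, and $p\in[2,\infty]$. Let $S:H\to L_p(\mu)$ be a compact linear operator such that $$e_n\bigl(S:H\to L_2(\mu)\bigr)\asymp n^{-1/\alpha}$$ for some $\alpha\in(0,2)$. Then, for all $q\in[2,p]$, the following equivalence holds: $$d_n\bigl(S:H\to L_q(\mu)\bigr)\asymp n^{-1/\alpha}\quad\Longleftrightarrow\quad e_n\bigl(S:H\to L_q(\mu)\bigr)\asymp n^{-1/\alpha}.$$
   Context: For a Banach space $E$, $B_E$ denotes its closed unit ball. For sequences $(a_n)_{n\ge1},(b_n)_{n\ge1}$ of nonnegative reals, $a_n\prec b_n$ means that there is a constant $c\in(0,\infty)$ with $a_n\le c\,b_n$ for all $n\ge1$; $a_n\asymp b_n$ means $a_n\prec b_n$ and $b_n\prec a_n$. For a bounded linear operator $T:E\to F$ between Banach spaces and $n\ge1$: - the $n$-th (dyadic) entropy number is $e_n(T):=\inf\{\varepsilon>0:\exists\,x_1,\dots,x_{2^{n-1}}\in F \text{ with } TB_E\subset\bigcup_{i=1}^{2^{n-1}}(x_i+\varepsilon B_F)\}$; - the $n$-th Kolmogorov number is $d_n(T):=\inf\{\|Q_{F_0}^F T\|: F_0\subset F \text{ a subspace with }\dim F_0<n\}$, where $Q_{F_0}^F:F\to F/F_0$ is the canonical quotient map; equivalently $d_n(T)=\inf_{F_0}\sup_{y\in TB_E}\inf_{z\in F_0}\|y-z\|_F$ over subspaces $F_0$ of $F$ with $\dim F_0<n$. For $q\in[2,p]$, since $\mu$ is finite,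 $L_p(\mu)\subset L_q(\mu)$ continuously, and $S:H\to L_q(\mu)$ denotes the composition of $S:H\to L_p(\mu)$ with this inclusion. *)

(* Defs.v *)
From HB Require Import structures.
From mathcomp Require Import all_boot all_order all_algebra.
From mathcomp Require Import sesquilinear.
From mathcomp Require Import all_classical all_reals all_analysis.
From mathcomp Require Import measurable_realfun ess_sup_inf hoelder.

Set Implicit Arguments.
Unset Strict Implicit.
Unset Printing Implicit Defensive.

Import Order.TTheory GRing.Theory Num.Theory.
Import numFieldNormedType.Exports.

Local Open Scope classical_set_scope.
Local Open Scope ring_scope.

(* The library provides the type [LspaceType mu p1] of a.e.-classes of
   p-integrable functions, but no algebraic or metric structure on it. *)
Section Lspace_class.
Context d (T : measurableType d) (R : realType).
Variables (mu : {measure set T -> \bar R}) (p : \bar R) (p1 : (1 <= p)%E).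
Local Open Scope quotient_scope.

Lemma Lnorm_ae (f g : T -> R) :
  measurable_fun setT f -> measurable_fun setT g -> f = g %[ae mu] ->
  ('N[mu]_p [EFin \o f] = 'N[mu]_p [EFin \o g])%E.
Proof.
move=> mf mg fg; rewrite unlock /Lnorm; case: p p1 => [r| |] r1 //.
  congr (_ `^ _)%E; apply: ge0_ae_eq_integral => //.
  - apply: (measurableT_comp (measurable_poweR _)) => //.
    by apply: measurableT_comp => //; exact/measurable_EFinP.
  - apply: (measurableT_comp (measurable_poweR _)) => //.
    by apply: measurableT_comp => //; exact/measurable_EFinP.
  - by move=> x _; exact: poweR_ge0.
  - by move=> x _; exact: poweR_ge0.
  - by apply: filterS fg => x fgx _ /=; rewrite fgx.
case: ifP => // _; apply: eq_ess_sup.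
by apply: filterS fg => x fgx /=; rewrite fgx.
Qed.

Lemma Lspace_measurable (x : LspaceType mu p1) :
  measurable_fun setT (x : T -> R).
Proof. exact: (measurable_funP (repr (x : aeEqMfun _ mu))). Qed.

Lemma Lspace_repr_Lfun (x : LspaceType mu p1) : (x : T -> R) \in Lfun mu p.
Proof.
rewrite inE; apply/andP; split; rewrite inE /=; last exact: Lebesgue_finite.
exact: Lspace_measurable.
Qed.

Definition Lspace_repr (x : LspaceType mu p1) : LfunType mu p1 :=
  Lfun_Sub p1 (Lspace_repr_Lfun x).

(* [LspaceType] is built on functions into [measurableTypeR R], which carries
   the same sigma-algebra as [R] but is a distinct measurable type. *)
Definition Lfun_measR (f : LfunType mu p1) : T -> measurableTypeR R := f.

Lemma Lfun_measR_measurable (f : LfunType mu p1) :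
  measurable_fun setT (Lfun_measR f).
Proof. exact: (measurable_funP f). Qed.

HB.instance Definition _ (f : LfunType mu p1) :=
  @isMeasurableFun.Build _ _ T (measurableTypeR R) (Lfun_measR f)
    (Lfun_measR_measurable f).

Definition Lfun_pi (f : LfunType mu p1) : aeEqMfun (measurableTypeR R) mu :=
  \pi_(aeEqMfun (measurableTypeR R) mu)
    (Lfun_measR f : {mfun T >-> measurableTypeR R}).

Lemma Lfun_pi_ae (f : LfunType mu p1) : (Lfun_pi f : T -> R) = f %[ae mu].
Proof.
have /eqP : repr (Lfun_pi f)
    = (Lfun_measR f : {mfun T >-> measurableTypeR R})
        %[mod aeEqMfun (measurableTypeR R) mu] by rewrite reprK.
by rewrite eqmodE => /asboolP.
Qed.

Lemma Lfun_pi_finite (f : LfunType mu p1) : finite_norm mu p (Lfun_pi f).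
Proof.
rewrite /finite_norm (@Lnorm_ae _ f) //; last exact: Lfun_pi_ae.
- exact: Lfunction_finite.
- exact: (measurable_funP (repr (Lfun_pi f))).
Qed.

HB.instance Definition _ (f : LfunType mu p1) :=
  @isFinLebesgue.Build d T R mu p p1 (Lfun_pi f) (Lfun_pi_finite f).

Definition Lspace_class (f : LfunType mu p1) : LspaceType mu p1 := Lfun_pi f.

Lemma Lspace_class_ae (f : LfunType mu p1) :
  (Lspace_class f : T -> R) = f %[ae mu].
Proof. exact: Lfun_pi_ae. Qed.

Lemma Lspace_eqP (x y : LspaceType mu p1) :
  x = y <-> (x : T -> R) = y %[ae mu].
Proof.
split=> [->|xy]; first exact: ae_eq_refl.
have e : (x : aeEqMfun _ mu) = y.
  by rewrite -[LHS]reprK -[RHS]reprK; apply/eqP; rewrite eqmodE; apply/asboolP.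
case: x y e {xy} => [x [[px]]] [y [[py]]] /= e.
by move: e px py => -> px py; have -> : px = py by exact: Prop_irrelevance.
Qed.

Lemma Lspace_classP (f g : LfunType mu p1) :
  f = g %[ae mu] -> Lspace_class f = Lspace_class g.
Proof.
move=> fg; apply/Lspace_eqP; apply: ae_eq_trans (Lspace_class_ae f) _.
by apply: ae_eq_trans fg _; apply: ae_eq_sym; exact: Lspace_class_ae.
Qed.

Lemma Lspace_reprK : cancel Lspace_repr Lspace_class.
Proof. by move=> x; apply/Lspace_eqP; exact: Lspace_class_ae. Qed.

Lemma Lspace_classK (f : LfunType mu p1) :
  (Lspace_repr (Lspace_class f) : T -> R) = f %[ae mu].
Proof. exact: Lspace_class_ae. Qed.

HB.instance Definition _ := gen_eqMixin (LspaceType mu p1).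
HB.instance Definition _ := gen_choiceMixin (LspaceType mu p1).

Definition Lspace_add (x y : LspaceType mu p1) :=
  Lspace_class (Lspace_repr x + Lspace_repr y).
Definition Lspace_opp (x : LspaceType mu p1) :=
  Lspace_class (- Lspace_repr x).
Definition Lspace_scale (a : R) (x : LspaceType mu p1) :=
  Lspace_class (a *: Lspace_repr x).

Lemma Lspace_class_add (f g : LfunType mu p1) :
  Lspace_class (f + g) = Lspace_add (Lspace_class f) (Lspace_class g).
Proof.
apply: Lspace_classP.
apply: filterS2 (Lspace_classK f) (Lspace_classK g) => x /(_ I) fE /(_ I) gE _.
exact: (f_equal2 +%R (esym fE) (esym gE)).
Qed.

Lemma Lspace_class_opp (f : LfunType mu p1) :
  Lspace_class (- f) = Lspace_opp (Lspace_class f).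
Proof.
apply: Lspace_classP; apply: filterS (Lspace_classK f) => x /(_ I) fE _.
exact: (f_equal -%R (esym fE)).
Qed.

Lemma Lspace_class_scale a (f : LfunType mu p1) :
  Lspace_class (a *: f) = Lspace_scale a (Lspace_class f).
Proof.
apply: Lspace_classP; apply: filterS (Lspace_classK f) => x /(_ I) fE _.
exact: (f_equal ( *%R a) (esym fE)).
Qed.

Lemma Lspace_addA : associative Lspace_add.
Proof.
move=> x y z; rewrite -[x]Lspace_reprK -[y]Lspace_reprK -[z]Lspace_reprK.
by rewrite -!Lspace_class_add addrA.
Qed.

Lemma Lspace_addC : commutative Lspace_add.
Proof. by move=> x y; rewrite /Lspace_add addrC. Qed.

Lemma Lspace_add0 : left_id (Lspace_class 0) Lspace_add.
Proof.
by move=> x; rewrite -[x]Lspace_reprK -Lspace_class_add add0r.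
Qed.

Lemma Lspace_addN : left_inverse (Lspace_class 0) Lspace_opp Lspace_add.
Proof.
by move=> x; rewrite -[x]Lspace_reprK -Lspace_class_opp -Lspace_class_add addNr.
Qed.

HB.instance Definition _ := GRing.isZmodule.Build (LspaceType mu p1)
  Lspace_addA Lspace_addC Lspace_add0 Lspace_addN.

Lemma Lspace_classD (f g : LfunType mu p1) :
  Lspace_class (f + g) = Lspace_class f + Lspace_class g.
Proof. exact: Lspace_class_add. Qed.

Lemma Lspace_scaleA a b (x : LspaceType mu p1) :
  Lspace_scale a (Lspace_scale b x) = Lspace_scale (a * b) x.
Proof.
by rewrite -[x]Lspace_reprK -!Lspace_class_scale scalerA.
Qed.

Lemma Lspace_scale1 : left_id 1 Lspace_scale.
Proof. by move=> x; rewrite -[x]Lspace_reprK -Lspace_class_scale scale1r. Qed.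

Lemma Lspace_scaleDr : right_distributive Lspace_scale +%R.
Proof.
move=> a x y; rewrite -[x]Lspace_reprK -[y]Lspace_reprK.
by rewrite -Lspace_classD -!Lspace_class_scale -Lspace_classD scalerDr.
Qed.

Lemma Lspace_scaleDl (x : LspaceType mu p1) :
  {morph Lspace_scale ^~ x : a b / a + b}.
Proof.
move=> a b /=; rewrite -[x]Lspace_reprK.
by rewrite -!Lspace_class_scale -Lspace_classD scalerDl.
Qed.

HB.instance Definition _ := GRing.Zmodule_isLmodule.Build R (LspaceType mu p1)
  Lspace_scaleA Lspace_scale1 Lspace_scaleDr Lspace_scaleDl.

Lemma Lspace_classZ a (f : LfunType mu p1) :
  Lspace_class (a *: f) = a *: Lspace_class f.
Proof. exact: Lspace_class_scale. Qed.

Definition Lspace_norm (x : LspaceType mu p1) : R :=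
  fine ('N[mu]_p [EFin \o (x : T -> R)])%E.

Lemma Lspace_norm_class (f : LfunType mu p1) :
  Lspace_norm (Lspace_class f) = fine ('N[mu]_p [EFin \o f])%E.
Proof.
congr fine; apply: Lnorm_ae; [exact: Lspace_measurable|by []|].
exact: Lspace_class_ae.
Qed.

Lemma Lspace_normD x y : Lspace_norm (x + y) <= Lspace_norm x + Lspace_norm y.
Proof.
rewrite -[x]Lspace_reprK -[y]Lspace_reprK.
by rewrite -Lspace_classD !Lspace_norm_class; exact: ler_LnormD.
Qed.

Lemma Lspace_normZ a (x : LspaceType mu p1) :
  Lspace_norm (a *: x) = `|a| * Lspace_norm x.
Proof.
rewrite -[x]Lspace_reprK -Lspace_classZ !Lspace_norm_class; apply: EFin_inj.
by rewrite EFinM !finite_norm_fine; exact: LnormZ.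
Qed.

Lemma Lspace_norm_eq0 (x : LspaceType mu p1) : Lspace_norm x = 0 -> x = 0.
Proof.
rewrite -[x]Lspace_reprK Lspace_norm_class => /fine_Lnormr_eq0 x0.
exact: (@Lspace_classP _ 0 x0).
Qed.

HB.instance Definition _ := Lmodule_isNormed.Build R (LspaceType mu p1)
  Lspace_normD Lspace_normZ Lspace_norm_eq0.

End Lspace_class.

Section Lspace_incl.
Context d (T : measurableType d) (R : realType).
Variables (mu : {finite_measure set T -> \bar R}) (p q : \bar R).
Hypotheses (p1 : (1 <= p)%E) (q1 : (1 <= q)%E) (qp : (q <= p)%E).

Lemma Lspace_incl_subproof (x : LspaceType mu p1) : (x : T -> R) \in Lfun mu q.
Proof.
apply: (Lfun_subset q1 p1 _ qp); last exact: Lspace_repr_Lfun.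
exact: fin_num_measure.
Qed.

Definition Lspace_incl (x : LspaceType mu p1) : LspaceType mu q1 :=
  Lspace_class (Lfun_Sub q1 (Lspace_incl_subproof x)).

Lemma Lspace_incl_ae (x : LspaceType mu p1) :
  (Lspace_incl x : T -> R) = x %[ae mu].
Proof. exact: Lspace_class_ae. Qed.

Lemma Lspace_incl_linear : linear Lspace_incl.
Proof.
move=> a x y; apply/Lspace_eqP.
have lin r (r1 : (1 <= r)%E) b (u v : LspaceType mu r1) :
    (b *: u + v : T -> R) = (fun t => b * u t + v t) %[ae mu].
  have e : b *: u + v = Lspace_class (b *: Lspace_repr u + Lspace_repr v).
    by rewrite Lspace_classD Lspace_classZ !Lspace_reprK.
  by rewrite e; exact: Lspace_class_ae.
apply: ae_eq_trans (Lspace_incl_ae _) _.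
apply: ae_eq_trans (lin _ _ _ _ _) _.
apply: ae_eq_sym; apply: ae_eq_trans (lin _ _ _ _ _) _.
apply: filterS2 (Lspace_incl_ae x) (Lspace_incl_ae y) => t /= + + _.
by move=> -> // ->.
Qed.

HB.instance Definition _ := GRing.isLinear.Build R (LspaceType mu p1)
  (LspaceType mu q1) _ Lspace_incl Lspace_incl_linear.

End Lspace_incl.

Section widths.
Context (R : realType).
Implicit Types E F : normedModType R.

Definition unit_ball E : set E := closed_ball_ Num.norm 0 1.

(* [precompact A] is equivalent to [compact (closure A)], see precompactE. *)
Definition compact_op E F (S : {linear E -> F}) :=
  precompact (S @` @unit_ball E).

(* [inf] and [sup] return 0 on empty or unbounded sets; for a bounded S and n >= 1
   the sets below are nonempty and bounded on the relevant side. *)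
Definition entropy_number E F (S : {linear E -> F}) (n : nat) : R :=
  inf [set eps | 0 < eps /\ exists x : 'I_(2 ^ n.-1) -> F,
    S @` @unit_ball E `<=` \bigcup_i closed_ball_ Num.norm (x i) eps].

Definition lin_span F k (v : 'I_k -> F) : set F :=
  [set \sum_(i < k) c i *: v i | c in [set: 'I_k -> R]].

Definition lin_indep F k (v : 'I_k -> F) :=
  forall c : 'I_k -> R, \sum_(i < k) c i *: v i = 0 -> forall i, c i = 0.

Definition is_subspace_dim F (F0 : set F) (k : nat) :=
  exists2 v : 'I_k -> F, lin_indep v & F0 = lin_span v.

(* Norm in the quotient by F0 of the class of y, and operator norm of S composed
   with the canonical quotient map. *)
Definition quotient_norm F (F0 : set F) (y : F) : R :=
  inf [set `|y - z| | z in F0].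

Definition quotient_op_norm E F (F0 : set F) (S : {linear E -> F}) : R :=
  sup [set quotient_norm F0 (S x) | x in @unit_ball E].

Definition kolmogorov_number E F (S : {linear E -> F}) (n : nat) : R :=
  inf [set quotient_op_norm F0 S | F0 in
    [set F0 | exists2 k, (k < n)%N & is_subspace_dim F0 k]].

Definition seq_dominated (a b : nat -> R) :=
  exists2 c : R, 0 < c & forall n, (1 <= n)%N -> a n <= c * b n.

Definition seq_equiv (a b : nat -> R) := seq_dominated a b /\ seq_dominated b a.

End widths.

Lemma ge2_ge1 (R : realType) (p : \bar R) : (2%:E <= p)%E -> (1 <= p)%E.
Proof. by apply: le_trans; rewrite lee_fin ler1n. Qed.

(* Main.v *)
Require Import Defs.
From HB Require Import structures.
From mathcomp Require Import all_boot all_order all_algebra.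
From mathcomp Require Import sesquilinear.
From mathcomp Require Import all_classical all_reals all_analysis.
From mathcomp Require Import measurable_realfun ess_sup_inf hoelder.
From mathcomp Require Import ring lra zify.

(* Write e_n, d_n for the numbers of u : H -> L_q(mu).  Carl's inequality bounds
   e_n by d_n at polynomial rates, and e_n is bounded below since it dominates
   the entropy numbers into L_2(mu).  Applied with the exponent 2 / alpha, Carl's
   inequality also shows that d_n cannot be much smaller than n^(-1/alpha) at a
   single n once d_k <= C k^(-1/alpha) for all k and e_m >= c m^(-1/alpha).

   There remains d_n <= C n^(-1/alpha) from e_n <= C n^(-1/alpha), which holds for
   u : H -> F with F any normed space because alpha < 2.  Let K be the set of h
   in H with <h, x> <= |u x| for all x, the polar of {|u x| <= 1}.  Tomczak-Jaegermann's
   duality argument transfers the entropy rate of u to K in H.  If g_1, ..., g_n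
   are random signed sums of an orthonormal family, a chaining argument, whose
   series converges because alpha < 2, shows that with positive probability no
   h in K of norm rho ~ n^(-1/alpha) is orthogonal to all the g_i.  By separation
   this says that u maps the unit ball into the rho-neighbourhood of the span of
   the u g_i. *)

Set Implicit Arguments.
Unset Strict Implicit.
Unset Printing Implicit Defensive.

Import Order.TTheory GRing.Theory Num.Theory.
Import numFieldNormedType.Exports.

Local Open Scope classical_set_scope.
Local Open Scope ring_scope.

(** How alpha < 2 enters: at scale 2^(-k) the net of K has log-size of order 2^(alpha k), while n
    draws let a sub-Gaussian increment of that scale deviate by a factor r^k with probability about
    exp(- n r^(2k)). The nets are beaten if r^2 >= 2^alpha and the deviations (r/2)^k are summable
    if r < 2; some r does both exactly when alpha < 2. Probability is a finite average over signs.
    Every requirement is an exponential test of mean below 1; over n independent draws the mean of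
    the product is bounded by an n-th power, and once the expected total over all tests is below 1,
    one choice of g_1, ..., g_n meets all requirements together. For the lower bound on d_n: n
    vectors that approximate u too well at n serve for every dimension from n to 2^k n as well.
    Renormalised at n, the faster rate n^(-2/alpha) then holds up to 2^k n, and Carl's inequality
    there pushes the entropy numbers below their lower bound once a fixed k is large enough. *)

Section exponential_bounds.
Context {R : realType}.
Implicit Types x y t : R.

(** Multiplied by [(1 + x / 2) ^+ 2 <= expR x], the right-hand side becomes 1 + x^3/2 + 3x^4/16: the
    coefficient 3/4 is the one that cancels the quadratic term. *)
Lemma expRN_le_quad x : 0 <= x -> expR (- x) <= 1 - x + 3 / 4 * x ^+ 2.
Proof.
move=> x0; rewrite expRN -[leLHS]mulr1 ler_pdivrMl ?expR_gt0 //.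
have e2 : (1 + x / 2) ^+ 2 <= expR x.
  rewrite [leRHS](_ : _ = expR (x / 2) ^+ 2).
    rewrite ler_pXn2r ?nnegrE ?expR_ge0 ?expR_ge1Dx //.
    by rewrite addr_ge0 // divr_ge0.
  by rewrite expr2 -expRD -splitr.
have p0 : 0 <= 1 - x + 3 / 4 * x ^+ 2 by nra.
apply: le_trans (ler_wpM2r p0 e2).
have : 0 <= x ^+ 3 by rewrite exprn_ge0.
have : 0 <= x ^+ 4 by rewrite exprn_ge0.
nra.
Qed.

(* Near 0 this is 1 / (1 - x^2) <= exp (2 x^2); the duplication formula
   cosh (2 y) = 2 (cosh y)^2 - 1 carries the bound to all x. *)
Lemma cosh_le_expR x : (expR x + expR (- x)) / 2 <= expR (2 * x ^+ 2).
Proof.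
have [n] : exists n : nat, `|x| <= 2 ^+ n / 2.
  exists (Num.truncn (2 * `|x|)).+1.
  have /ltW := truncnS_gt (2 * `|x|); set n := (Num.truncn _).+1 => xn.
  have : n%:R <= 2 ^+ n :> R by rewrite -natrX ler_nat ltnW // ltn_expl.
  lra.
elim: n x => [|n IHn] x xn.
  have x2 : x ^+ 2 <= 1 / 4.
    rewrite -[x ^+ 2]real_normK ?num_real //.
    rewrite expr0 in xn. have := normr_ge0 x; nra.
  have /ler_normlP[xl xr] := xn; rewrite expr0 in xl xr.
  have e1 : expR x <= (1 - x)^-1.
    rewrite -[leLHS]invrK lef_pV2 ?posrE ?invr_gt0 ?expR_gt0 //; last lra.
    by rewrite -expRN; have := expR_ge1Dx (- x); lra.
  have e2 : expR (- x) <= (1 + x)^-1.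
    rewrite expRN lef_pV2 ?posrE ?expR_gt0 ?expR_ge1Dx //; lra.
  have e3 : 1 + 2 * x ^+ 2 <= expR (2 * x ^+ 2) by exact: expR_ge1Dx.
  apply: le_trans e3.
  have e4 : (1 - x)^-1 + (1 + x)^-1 = 2 / (1 - x ^+ 2).
    field; apply/and3P; split; apply/eqP; nra.
  apply: (@le_trans _ _ (1 - x ^+ 2)^-1); first lra.
  rewrite -[leLHS]mul1r ler_pdivrMr; last lra.
  have := sqr_ge0 x; nra.
have /IHn : `|x / 2| <= 2 ^+ n / 2.
  rewrite normrM [`|2^-1|]gtr0_norm //; move: xn; rewrite exprS; lra.
set c := (_ + _) / 2 => cle.
have -> : (expR x + expR (- x)) / 2 = 2 * c ^+ 2 - 1.
  rewrite /c [in LHS](splitr x) opprD !expRD !expRN.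
  field; rewrite expR_eq0 //.
have -> : 2 * x ^+ 2 = 2 * (x / 2) ^+ 2 + 2 * (x / 2) ^+ 2 +
                       (2 * (x / 2) ^+ 2 + 2 * (x / 2) ^+ 2) by field.
rewrite !expRD; set e := expR _ in cle *.
have c0 : 0 <= c by rewrite /c divr_ge0 // addr_ge0 // expR_ge0.
have ec : c ^+ 2 <= e ^+ 2 by rewrite ler_pXn2r // nnegrE ?expR_ge0.
have := sqr_ge0 (e ^+ 2 - 1); nra.
Qed.

End exponential_bounds.

(** * Hilbert space geometry and averages over random signs *)

Record inner_product (R : realType) (H : normedModType R) := InnerProduct {
  inner_fun :> H -> H -> R;
  inner_addl : forall x y z,
    inner_fun (x + y) z = inner_fun x z + inner_fun y z;
  inner_scalel : forall a x y, inner_fun (a *: x) y = a * inner_fun x y;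
  inner_sym : forall x y, inner_fun x y = inner_fun y x;
  inner_norm : forall x, inner_fun x x = `|x| ^+ 2 }.

Section inner_product_theory.
Context {R : realType} {H : normedModType R}.
Variable ip : inner_product H.
Implicit Types (u v w x y z g h : H) (bs : seq H).

Lemma ipDl x y z : ip (x + y) z = ip x z + ip y z.
Proof. exact: inner_addl. Qed.
Lemma ipZl a x y : ip (a *: x) y = a * ip x y.
Proof. exact: inner_scalel. Qed.
Lemma ipC x y : ip x y = ip y x.
Proof. exact: inner_sym. Qed.
Lemma ip_norm x : ip x x = `|x| ^+ 2.
Proof. exact: inner_norm. Qed.
Lemma ipDr x y z : ip x (y + z) = ip x y + ip x z.
Proof. by rewrite ipC ipDl ![ip _ x]ipC. Qed.
Lemma ipZr a x y : ip x (a *: y) = a * ip x y.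
Proof. by rewrite ipC ipZl ipC. Qed.
Lemma ipNl x y : ip (- x) y = - ip x y.
Proof. by rewrite -scaleN1r ipZl mulN1r. Qed.
Lemma ipNr x y : ip x (- y) = - ip x y.
Proof. by rewrite ipC ipNl ipC. Qed.
Lemma ipBl x y z : ip (x - y) z = ip x z - ip y z.
Proof. by rewrite ipDl ipNl. Qed.
Lemma ipBr x y z : ip x (y - z) = ip x y - ip x z.
Proof. by rewrite ipDr ipNr. Qed.
Lemma ip0l y : ip 0 y = 0.
Proof. by rewrite -(scale0r 0) ipZl mul0r. Qed.
Lemma ip0r y : ip y 0 = 0.
Proof. by rewrite ipC ip0l. Qed.
Lemma ip_suml I (s : seq I) (f : I -> H) y :
  ip (\sum_(i <- s) f i) y = \sum_(i <- s) ip (f i) y.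
Proof. by elim/big_rec2: _ => [|i a b _ <-]; rewrite ?ip0l ?ipDl. Qed.
Lemma ip_sumr I (s : seq I) (f : I -> H) y :
  ip y (\sum_(i <- s) f i) = \sum_(i <- s) ip y (f i).
Proof. by rewrite ipC ip_suml; apply: eq_bigr => i _; rewrite ipC. Qed.

Lemma normB_sqr x y : `|x - y| ^+ 2 = `|x| ^+ 2 - 2 * ip x y + `|y| ^+ 2.
Proof. by rewrite -!ip_norm ipBl !ipBr [ip y x]ipC; ring. Qed.

Lemma ip_le x y : `|ip x y| <= `|x| * `|y|.
Proof.
have [->|y0] := eqVneq y 0; first by rewrite ip0r normr0 mulr_ge0.
rewrite -(@ler_pXn2r _ 2) ?nnegrE ?mulr_ge0 // real_normK ?num_real // exprMn.
have := sqr_ge0 `|(`|y| ^+ 2 *: x - ip x y *: y)|.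
rewrite normB_sqr !normrZ ipZl ipZr !exprMn !real_normK ?num_real //.
have : 0 < `|y| ^+ 2 by rewrite exprn_gt0 // normr_gt0.
move: (`|y| ^+ 2) (`|x| ^+ 2) (ip x y) => b a c b0 p0.
rewrite -(ler_pM2l b0); nra.
Qed.

Definition frame_proj bs v := \sum_(b <- bs) ip v b *: b.
Definition frame_sq bs v := \sum_(b <- bs) ip v b ^+ 2.

Lemma frame_projC bs v w : ip (frame_proj bs v) w = ip v (frame_proj bs w).
Proof.
rewrite ip_suml ip_sumr; apply: eq_bigr => b _.
by rewrite ipZl ipZr mulrC [ip w b]ipC.
Qed.

Lemma frame_projE bs v : ip (frame_proj bs v) v = frame_sq bs v.
Proof. by rewrite ip_suml; apply: eq_bigr => b _; rewrite ipZl [ip b v]ipC. Qed.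

Lemma frame_projD bs v w :
  frame_proj bs (v + w) = frame_proj bs v + frame_proj bs w.
Proof.
rewrite /frame_proj -big_split; apply: eq_bigr => b _.
by rewrite ipDl scalerDl.
Qed.

Lemma frame_projZ bs a v : frame_proj bs (a *: v) = a *: frame_proj bs v.
Proof.
rewrite /frame_proj scaler_sumr; apply: eq_bigr => b _.
by rewrite ipZl scalerA.
Qed.

Lemma frame_projB bs v w :
  frame_proj bs (v - w) = frame_proj bs v - frame_proj bs w.
Proof. by rewrite frame_projD -scaleN1r frame_projZ scaleN1r. Qed.

(** Idempotence is what is kept of orthonormality: together with the symmetry [frame_projC] it makes
    [frame_proj bs] an orthogonal projection, which yields Bessel's inequality and, on its range,
    Parseval's identity. *)
Definition frame bs := forall v, frame_proj bs (frame_proj bs v) = frame_proj bs v.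

Lemma frame_residual bs v : frame bs ->
  `|v - frame_proj bs v| ^+ 2 = `|v| ^+ 2 - frame_sq bs v.
Proof.
move=> fbs; rewrite normB_sqr -[`|frame_proj _ _| ^+ 2]ip_norm.
by rewrite frame_projC fbs ipC frame_projE; ring.
Qed.

Lemma frame_sq_le bs v : frame bs -> frame_sq bs v <= `|v| ^+ 2.
Proof. by move=> fbs; rewrite -subr_ge0 -frame_residual // sqr_ge0. Qed.

Lemma frame_sq_fix bs v : frame bs -> frame_proj bs v = v ->
  frame_sq bs v = `|v| ^+ 2.
Proof.
move=> fbs vE; have := frame_residual v fbs.
by rewrite vE subrr normr0 expr0n /= => /esym/subr0_eq.
Qed.

(** Gram-Schmidt: each new vector contributes its normalised residual, or nothing if the residual
    vanishes. *)
Lemma frame_exists (s : seq H) :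
  exists2 bs, frame bs & forall w, w \in s -> frame_proj bs w = w.
Proof.
elim: s => [|w s [bs fbs sbs]].
  by exists [::] => [v|w //]; rewrite /frame_proj !big_nil.
set r := w - frame_proj bs w.
have Pr : frame_proj bs r = 0 by rewrite frame_projB fbs subrr.
have [r0|rN0] := eqVneq r 0.
  exists bs => // v; rewrite inE => /predU1P[->|/sbs //].
  by apply/esym/subr0_eq.
pose b := `|r|^-1 *: r.
have nr0 : `|r| != 0 by rewrite normr_eq0.
have Pb : frame_proj bs b = 0 by rewrite frame_projZ Pr scaler0.
have bb : ip b b = 1 by rewrite ipZl ipZr ip_norm; field.
have PE v : frame_proj (b :: bs) v = ip v b *: b + frame_proj bs v.
  by rewrite /frame_proj big_cons.
have Pvb v : ip (frame_proj bs v) b = 0 by rewrite frame_projC Pb ip0r.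
exists (b :: bs) => [v|v].
  rewrite !PE ipDl ipZl bb mulr1 Pvb addr0; congr (_ + _).
  by rewrite frame_projD frame_projZ Pb scaler0 add0r fbs.
rewrite inE => /predU1P[->|vs]; rewrite PE; last first.
  by rewrite -{1}(sbs v vs) Pvb scale0r add0r sbs.
suff -> : ip w b = `|r| by rewrite /b scalerA divff // scale1r subrK.
have -> : w = r + frame_proj bs w by rewrite subrK.
by rewrite ipDl Pvb addr0 ipZr ip_norm; field.
Qed.

(** The expectation of f(sum of +-b) over independent uniform signs, unfolded one sign at a time so
    that every moment estimate is an induction on [bs]. *)
Fixpoint sign_mean bs (f : H -> R) : R :=
  if bs is b :: bs' then
    (sign_mean bs' (fun g => f (b + g)) + sign_mean bs' (fun g => f (- b + g))) / 2
  else f 0.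

Lemma sign_meanD bs (f1 f2 : H -> R) :
  sign_mean bs (fun g => f1 g + f2 g) = sign_mean bs f1 + sign_mean bs f2.
Proof.
elim: bs f1 f2 => [//|b bs IH] f1 f2 /=.
by rewrite (IH (fun g => f1 _)) (IH (fun g => f1 (- b + g))); field.
Qed.

Lemma sign_meanZ bs a (f : H -> R) :
  sign_mean bs (fun g => a * f g) = a * sign_mean bs f.
Proof.
elim: bs f => [//|b bs IH] f /=.
by rewrite (IH (fun g => f (b + g))) (IH (fun g => f (- b + g))); field.
Qed.

Lemma sign_mean_cst bs a : sign_mean bs (fun=> a) = a.
Proof. by elim: bs => //= b bs ->; field. Qed.

Lemma sign_mean_sum I (s : seq I) bs (f : I -> H -> R) :
  sign_mean bs (fun g => \sum_(i <- s) f i g) =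
  \sum_(i <- s) sign_mean bs (f i).
Proof.
elim: s => [|i s IH].
  rewrite big_nil (_ : (fun g => _) = fun=> 0) ?sign_mean_cst //.
  by apply/funext => g; rewrite big_nil.
rewrite big_cons -IH -sign_meanD; congr sign_mean.
by apply/funext => g; rewrite big_cons.
Qed.

Lemma ler_sign_mean bs (f1 f2 : H -> R) :
  (forall g, f1 g <= f2 g) -> sign_mean bs f1 <= sign_mean bs f2.
Proof.
elim: bs f1 f2 => [|b bs IH] f1 f2 f12 //=.
by rewrite ler_pM2r // lerD // IH.
Qed.

(** A finite average is at least one of its values. The norm bound on the chosen vector later
    controls the end of each chain. *)
Lemma sign_mean_attained bs (f : H -> R) :
  exists2 g, `|g| <= \sum_(b <- bs) `|b| & f g <= sign_mean bs f.
Proof.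
elim: bs f => [|b bs IH] f /=; first by exists 0 => //; rewrite normr0 big_nil.
have [g1 n1 f1] := IH (fun g => f (b + g)).
have [g2 n2 f2] := IH (fun g => f (- b + g)).
rewrite big_cons; have [le12|/ltW le21] := leP (f (b + g1)) (f (- b + g2)).
  by exists (b + g1); [rewrite (le_trans (ler_normD _ _)) ?lerD|lra].
exists (- b + g2); last lra.
by rewrite (le_trans (ler_normD _ _)) ?lerD // normrN.
Qed.

(** Sub-Gaussian bound: independent signs factor the exponential, and each factor is a hyperbolic
    cosine. *)
Lemma sign_mean_expR bs v a :
  sign_mean bs (fun g => expR (a * ip v g)) <=
  expR (2 * a ^+ 2 * frame_sq bs v).
Proof.
elim: bs => [|b bs IH] /=; first by rewrite ip0r /frame_sq big_nil !mulr0.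
have shift c : sign_mean bs (fun g => expR (a * ip v (c + g))) =
    expR (a * ip v c) * sign_mean bs (fun g => expR (a * ip v g)).
  rewrite -sign_meanZ; congr sign_mean; apply/funext => g.
  by rewrite ipDr mulrDr expRD.
rewrite (shift b) (shift (- b)) ipNr mulrN -mulrDl mulrAC.
rewrite /frame_sq big_cons mulrDr expRD.
have := @cosh_le_expR R (a * ip v b); rewrite exprMn mulrA => ch.
by apply: ler_pM => //; rewrite ?divr_ge0 ?addr_ge0 ?expR_ge0 //
  -(sign_mean_cst bs 0) ler_sign_mean // => g; exact: expR_ge0.
Qed.

Lemma sign_mean_sqr bs v t :
  sign_mean bs (fun g => (t + ip v g) ^+ 2) = t ^+ 2 + frame_sq bs v.
Proof.
elim: bs t => [|b bs IH] t /=; first by rewrite ip0r /frame_sq big_nil !addr0.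
have shift c : (fun g => (t + ip v (c + g)) ^+ 2) =
    (fun g => ((t + ip v c) + ip v g) ^+ 2).
  by apply/funext => g; rewrite ipDr addrA.
by rewrite !shift !IH ipNr /frame_sq big_cons; field.
Qed.

(** The shift [t] lets the induction close; each step has a surplus 2c^4. At t = 0 this is the
    Khinchin bound by 3 times the squared variance. *)
Lemma sign_mean_pow4 bs v t :
  sign_mean bs (fun g => (t + ip v g) ^+ 4) <=
  t ^+ 4 + 6 * t ^+ 2 * frame_sq bs v + 3 * frame_sq bs v ^+ 2.
Proof.
elim: bs t => [|b bs IH] t /=.
  by rewrite ip0r /frame_sq big_nil expr0n /= !mulr0 !addr0.
have shift c : (fun g => (t + ip v (c + g)) ^+ 4) =
    (fun g => ((t + ip v c) + ip v g) ^+ 4).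
  by apply/funext => g; rewrite ipDr addrA.
rewrite !shift; have := IH (t + ip v b); have := IH (t - ip v b).
rewrite ipNr /frame_sq big_cons -/(frame_sq bs v).
move: (frame_sq bs v) (ip v b) => q c.
have := sqr_ge0 (c ^+ 2).
set s1 := sign_mean _ _; set s2 := sign_mean _ _ => c4 h1 h2.
nra.
Qed.

(** A Paley-Zygmund effect: second and fourth moments prevent [ip v g] from being mostly small, so
    the Laplace transform of its absolute value is at most 29/32 <= exp(-3/32). Half of that
    exponent is spent on the shift 3/64, half remains as the bound. *)
Lemma sign_mean_small_ball bs v t : 0 < t -> t ^+ 2 <= frame_sq bs v ->
  sign_mean bs (fun g => expR (3 / 64 - `|ip v g| / (2 * t))) <= expR (- (3 / 64)).
Proof.
move=> t0 tv; set q := frame_sq bs v in tv.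
have q0 : 0 < q by apply: lt_le_trans tv; rewrite exprn_gt0.
pose s := Num.sqrt q; have s0 : 0 < s by rewrite sqrtr_gt0.
have sq : s ^+ 2 = q by rewrite sqr_sqrtr // ltW.
have ts : t <= s by rewrite -(@ler_pXn2r _ 2) ?nnegrE ?sq ?(ltW t0) ?(ltW s0).
(* With X = |ip v g| / s this is the majorant 1 - 3X^2/16 + X^4/32, scaled by exp(3/64). It bounds
   exp(-X/2) and involves only the moments of order 2 and 4. *)
pose f g := (expR (3 / 64) * (- (3 / (16 * q)))) * (0 + ip v g) ^+ 2 +
  ((expR (3 / 64) / (32 * q ^+ 2)) * (0 + ip v g) ^+ 4 + expR (3 / 64)).
have fle g : expR (3 / 64 - `|ip v g| / (2 * t)) <= f g.
  rewrite expRD /f !add0r.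
  set e := expR (3 / 64); have e0 : 0 < e by exact: expR_gt0.
  have -> : e * - (3 / (16 * q)) * ip v g ^+ 2 +
    (e / (32 * q ^+ 2) * ip v g ^+ 4 + e) =
    e * (1 - 3 / 16 * (ip v g ^+ 2 / q) + (ip v g ^+ 2 / q) ^+ 2 / 32).
    by field; rewrite gt_eqF.
  rewrite ler_pM2l //.
  pose X := `|ip v g| / s.
  have X0 : 0 <= X by rewrite divr_ge0 // ltW.
  have X2 : ip v g ^+ 2 / q = X ^+ 2.
    by rewrite /X exprMn real_normK ?num_real // exprVn sq.
  rewrite X2.
  apply: (@le_trans _ _ (expR (- (X / 2)))).
    rewrite ler_expR lerN2 /X -mulrA -invfM [_ * 2]mulrC.
    by rewrite ler_wpM2l // lef_pV2 ?posrE ?mulr_gt0 // ler_pM2l.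
  apply: le_trans (expRN_le_quad _) _; first by rewrite divr_ge0.
  (* The gap between the majorant and 1 - X/2 + 3X^2/16 is X (X - 2)^2 (X + 4) / 32. *)
  have := mulr_ge0 (mulr_ge0 X0 (sqr_ge0 (X - 2))) (_ : 0 <= X + 4).
  by move=> /(_ (addr_ge0 X0 (ler0n _ _))) h; nra.
apply: le_trans (ler_sign_mean _ fle) _.
rewrite /f sign_meanD sign_meanZ sign_meanD sign_meanZ sign_mean_cst.
have := sign_mean_pow4 bs v 0; rewrite sign_mean_sqr -/q.
set M := sign_mean _ _; rewrite !expr0n /= !mulr0 !mul0r !add0r => M4.
rewrite expRN; set e := expR (3 / 64); have e0 : 0 < e by exact: expR_gt0.
rewrite -[e^-1]mulr1 ler_pdivlMl //.
have e2 : e * e <= 32 / 29.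
  rewrite -expRD -[leLHS]invrK -[leRHS]invrK lef_pV2 ?posrE ?invr_gt0 ?expR_gt0 //.
  by rewrite -expRN (le_trans _ (expR_ge1Dx _)) //; lra.
have Mq : M / q ^+ 2 <= 3 by rewrite ler_pdivrMr // exprn_gt0.
have -> : e * (e * - (3 / (16 * q)) * q + (e / (32 * q ^+ 2) * M + e)) =
  (e * e) * (13 / 16 + (M / q ^+ 2) / 32) by field; rewrite gt_eqF.
have ee0 : 0 <= e * e by rewrite mulr_ge0 ?ltW.
nra.
Qed.

(* Method of conditional expectations: picking g_1, ..., g_n one at a time
   never increases the expected total weight of the tests. *)
Lemma sign_selection bs (J : Type) (s : seq J) (psi : J -> H -> R) (a W : J -> R)
    n (e : R) :
  (forall j g, 0 <= psi j g) -> (forall j, 0 <= W j) ->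
  (forall j, sign_mean bs (psi j) <= a j) ->
  \sum_(j <- s) W j * a j ^+ n < e ->
  exists gs, [/\ size gs = n,
    forall g, g \in gs -> `|g| <= \sum_(b <- bs) `|b| &
    \sum_(j <- s) W j * \prod_(g <- gs) psi j g < e].
Proof.
move=> psi0 + psia; have a0 j : 0 <= a j.
  apply: le_trans (psia j); rewrite -(sign_mean_cst bs 0).
  exact: ler_sign_mean.
elim: n W => [|n IH] W W0 We.
  exists [::]; split=> //; move: We; congr (_ < _); apply: eq_bigr => j _.
  by rewrite big_nil.
have [g gb gle] := sign_mean_attained bs
  (fun g => \sum_(j <- s) (W j * a j ^+ n) * psi j g).
have : \sum_(j <- s) (W j * psi j g) * a j ^+ n < e.
  apply: le_lt_trans We; rewrite sign_mean_sum in gle.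
  under eq_bigr do rewrite mulrAC.
  apply: le_trans gle _; apply: ler_sum => j _.
  by rewrite sign_meanZ exprSr mulrA ler_wpM2l // mulr_ge0 // exprn_ge0.
move=> /IH[|gs [sgs gsb gse]]; first by move=> j; rewrite mulr_ge0.
exists (g :: gs); split=> [|h|]; first by rewrite /= sgs.
  by rewrite inE => /predU1P[->//|/gsb].
move: gse; congr (_ < _); apply: eq_bigr => j _.
by rewrite big_cons mulrA.
Qed.

End inner_product_theory.

(** * Random vectors detecting a set with small entropy *)

Section random_kernel.
Context {R : realType} {H : normedModType R}.
Variable ip : inner_product H.
Implicit Types (K : set H) (h g w z : H) (N : nat -> seq H).

(** The entropy rate e_n ~ n^(-1/a) in inverse form: metric entropy at scale [e] at most [C e^(-a)].
    Net points may lie outside [K]. *)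
Definition has_nets K (C a : R) := forall e, 0 < e -> exists2 N : seq H,
  (size N)%:R <= expR (C * e `^ (- a)) &
  forall h, K h -> exists2 z, z \in N & `|h - z| <= e.

Lemma powR_halves (x a : R) k : 0 <= x ->
  (x / 2 ^+ k) `^ (- a) = x `^ (- a) * (2 `^ a) ^+ k.
Proof.
move=> x0; elim: k => [|k IH]; first by rewrite !expr0 divr1 mulr1.
have -> : x / 2 ^+ k.+1 = (x / 2 ^+ k) * 2^-1 by rewrite exprSr invfM mulrA.
rewrite powRM ?divr_ge0 ?exprn_ge0 // IH exprSr mulrA; congr (_ * _).
by rewrite -powR_inv1 // -powRrM mulrN mulN1r opprK.
Qed.

Lemma sum_geo_le (x : R) m : 0 <= x -> x < 1 ->
  \sum_(k < m) x ^+ k <= (1 - x)^-1.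
Proof.
move=> x0 x1; have y0 : 0 < 1 - x by lra.
rewrite -[leRHS]mul1r ler_pdivlMr // mulrC.
have -> : (1 - x) * \sum_(k < m) x ^+ k = 1 - x ^+ m.
  by rewrite -[in RHS](expr1n _ m) subrXX; congr (_ * _);
    apply: eq_bigr => i _; rewrite expr1n mul1r.
by rewrite gerBl exprn_ge0.
Qed.

Lemma sum_halves_lt1 m : \sum_(k < m) (1 / 2 : R) ^+ k.+2 < 1.
Proof.
under eq_bigr do rewrite !exprS mulrA mulrC.
rewrite -mulr_suml; have h0 : 0 <= 1 / 2 :> R by lra.
have h1 : 1 / 2 < 1 :> R by lra.
have := sum_geo_le m h0 h1.
have -> : (1 - 1 / 2)^-1 = 2 :> R by field.
lra.
Qed.

Lemma sum_le_term (J : eqType) (s : seq J) (F : J -> R) j :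
  (forall i, 0 <= F i) -> j \in s -> F j <= \sum_(i <- s) F i.
Proof. by move=> F0 js; rewrite (big_rem j) //= lerDl sumr_ge0. Qed.

Section chaining.
Variables (rho theta r : R) (bs : seq H).
Hypotheses (rho0 : 0 < rho) (theta0 : 0 < theta).
Let eps k := theta * rho / 2 ^+ k.

Let eps0 k : 0 < eps k.
Proof. by rewrite /eps divr_gt0 ?mulr_gt0 // exprn_gt0. Qed.

(* Level 0 tests that a net point has no small coefficients; level k+1 tests
   that the k-th increment of a chain has no large ones. *)
Definition chain_test (j : nat * H) g : R :=
  if j.1 is k.+1 then
    if `|j.2| <= 3 / 2 * eps k
    then expR (r ^+ k / eps k * `|ip j.2 g| - 9 * r ^+ (2 * k)) else 0
  else if (rho / 2) ^+ 2 <= frame_sq ip bs j.2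
    then expR (3 / 64 - `|ip j.2 g| / (2 * (rho / 2))) else 0.

Definition chain_bound (j : nat * H) : R :=
  if j.1 is k.+1 then expR (1 - 9 / 2 * r ^+ (2 * k)) else expR (- (3 / 64)).

Lemma chain_test_ge0 j g : 0 <= chain_test j g.
Proof. by case: j => -[|k] w; rewrite /chain_test /=; case: ifP => // _; exact: expR_ge0. Qed.

Lemma sign_mean_chain_test j : frame ip bs ->
  sign_mean bs (chain_test j) <= chain_bound j.
Proof.
move=> fbs; case: j => -[|k] w; rewrite /chain_test /chain_bound /=.
  case: (boolP (_ <= frame_sq ip bs w)) => [hw|_].
    by apply: sign_mean_small_ball => //; rewrite divr_gt0.
  by rewrite sign_mean_cst expR_ge0.
case: (boolP (`|w| <= _)) => [hw|_]; last by rewrite sign_mean_cst expR_ge0.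
(* This slope makes the sub-Gaussian exponent at most 9/2 r^(2k), half of the subtracted 9 r^(2k).
   The absolute value costs a factor 2, absorbed by [2 <= expR 1]. *)
set l := r ^+ k / eps k.
have tle g : expR (l * `|ip w g| - 9 * r ^+ (2 * k)) <=
    expR (- (9 * r ^+ (2 * k))) * (expR (l * ip w g) + expR (- l * ip w g)).
  rewrite addrC expRD ler_pM2l ?expR_gt0 //.
  have [?|?] := ler0P (ip w g).
    by rewrite mulrN -mulNr lerDr expR_ge0.
  by rewrite lerDl expR_ge0.
apply: le_trans (ler_sign_mean _ tle) _.
rewrite sign_meanZ sign_meanD.
have h1 := sign_mean_expR ip bs w l; have := sign_mean_expR ip bs w (- l).
rewrite sqrrN => h2.
have l2 : 2 * l ^+ 2 * frame_sq ip bs w <= 9 / 2 * r ^+ (2 * k).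
  have : frame_sq ip bs w <= (3 / 2 * eps k) ^+ 2.
    apply: le_trans (frame_sq_le _ fbs) _.
    rewrite ler_pXn2r ?nnegrE ?normr_ge0 //.
    by apply: mulr_ge0 (ltW (eps0 k)); apply: divr_ge0.
  have l0 : 0 <= 2 * l ^+ 2 by rewrite mulr_ge0 // sqr_ge0.
  move=> /(ler_wpM2l l0) /le_trans; apply.
  rewrite /l exprMn exprVn -exprM [(k * 2)%N]mulnC.
  have := eps0 k; move: (eps k) => e e0.
  by rewrite le_eqVlt; apply/orP; left; apply/eqP; field; rewrite gt_eqF.
rewrite -ler_expR in l2.
have -> : 1 - 9 / 2 * r ^+ (2 * k) =
  - (9 * r ^+ (2 * k)) + (9 / 2 * r ^+ (2 * k) + 1) by field.
rewrite expRD ler_pM2l ?expR_gt0 // expRD.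
have := @expR_ge1Dx R 1; have := expR_gt0 (9 / 2 * r ^+ (2 * k)).
move: (expR (9 / 2 * _)) (expR 1) l2 => A B l2 A0 B0.
nra.
Qed.

Lemma sumr_const_seq (I : Type) (s : seq I) (c : R) :
  \sum_(i <- s) c = (size s)%:R * c.
Proof. by rewrite big_const_seq count_predT iter_addr_0 mulr_natl. Qed.

(** A product of exponentials below 1 means a negative sum of exponents; this turns a passed test
    into a lower bound on the sum of the |ip z g|, and in [chain_testS] into an upper bound. *)
Lemma chain_test0 gs z : rho / 2 <= `|z| -> frame ip bs -> frame_proj ip bs z = z ->
  \prod_(g <- gs) chain_test (0%N, z) g < 1 ->
  (size gs)%:R * (3 / 64 * rho) < \sum_(g <- gs) `|ip z g|.
Proof.
move=> zn fbs zE; rewrite /chain_test /= frame_sq_fix //.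
have -> : (rho / 2) ^+ 2 <= `|z| ^+ 2.
  by rewrite ler_pXn2r ?nnegrE ?normr_ge0 // divr_ge0 // ltW.
rewrite -expR_sum -[X in _ < X]expR0 ltr_expR sumrB sumr_const_seq subr_lt0.
rewrite -mulr_suml ltr_pdivlMr ?mulr_gt0 ?divr_gt0 //.
by rewrite [2 * _]mulrC divfK // !mulrA.
Qed.

Lemma chain_testS gs k w : 0 < r -> `|w| <= 3 / 2 * eps k ->
  \prod_(g <- gs) chain_test (k.+1, w) g < 1 ->
  \sum_(g <- gs) `|ip w g| <= (size gs)%:R * (9 * theta * rho) * (r / 2) ^+ k.
Proof.
move=> r0 wn; rewrite /chain_test /= wn.
rewrite -expR_sum -[X in _ < X]expR0 ltr_expR sumrB sumr_const_seq subr_lt0.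
rewrite -mulr_sumr => /ltW.
have l0 : 0 < r ^+ k / eps k by rewrite divr_gt0 // exprn_gt0.
rewrite -ler_pdivlMl // => /le_trans; apply.
rewrite le_eqVlt; apply/orP; left; apply/eqP; rewrite /eps mulnC exprM expr_div_n.
by field; rewrite !gt_eqF ?exprn_gt0.
Qed.

(** Union bound. The k-th increments number at most exp(5 t r^(2k)), against a factor exp(n (1 - 9/2
    r^(2k))) from the n draws. Since [2 <= r ^+ 2] gives r^(2k) >= k + 1, the levels decay
    geometrically. [chain_bound] depends on the level only, hence the dummy vector 0. *)
Lemma chain_bound_sum N n C a :
  0 <= C -> 0 < r -> r < 2 -> 2 `^ a <= r ^+ 2 -> 2 <= r ^+ 2 ->
  (forall k, (size (N k))%:R <= expR (C * eps k `^ (- a))) ->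
  16 * (C * (theta * rho) `^ (- a) + 4) <= 3 / 4 * n%:R ->
  forall M, \sum_(k < M) (size (if val k is k'.+1
      then [seq x - y | x <- N k'.+1, y <- N k'] else N 0%N))%:R *
    chain_bound (val k, 0) ^+ n < 1.
Proof.
move=> C0 r0 r2 r2a r22 sN nbig M; apply: le_lt_trans (sum_halves_lt1 M).
set t := C * _ in nbig.
have t0 : 0 <= t by rewrite mulr_ge0 ?powR_ge0.
have hexp (k : nat) : expR (- (2 * k%:R) : R) <= (1 / 2) ^+ k.
  rewrite mulrC -mulrN expRM_natl lerXn2r ?nnegrE ?expR_ge0 ?divr_ge0 //.
  rewrite expRN div1r lef_pV2 ?posrE ?expR_gt0 //.
  by have := @expR_ge1Dx R 2; lra.
have epsa k : C * eps k `^ (- a) <= t * r ^+ (2 * k).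
  rewrite /eps powR_halves ?mulr_ge0 ?(ltW theta0) ?(ltW rho0) // mulrA.
  rewrite ler_wpM2l // exprM.
  by rewrite lerXn2r ?nnegrE ?powR_ge0 ?sqr_ge0.
have r2k k : k.+1%:R <= r ^+ (2 * k).
  rewrite exprM (@le_trans _ _ (2 ^+ k)) //; last first.
    by rewrite lerXn2r ?nnegrE ?sqr_ge0.
  by rewrite -natrX ler_nat ltn_expl.
apply: ler_sum => -[k /= _] _; case: k => [|k]; rewrite /chain_bound /=.
  apply: (@le_trans _ _ (expR (t - 3 / 64 * n%:R))).
    rewrite expRD; apply: ler_pM; rewrite ?exprn_ge0 ?expR_ge0 //.
      by apply: le_trans (sN 0) _; rewrite ler_expR (le_trans (epsa 0)) // muln0 expr0 mulr1.
    by rewrite -expRM_natr mulNr.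
  apply: le_trans (hexp 2); rewrite ler_expR; lra.
apply: (@le_trans _ _ (expR (5 * t * r ^+ (2 * k) + (1 - 9 / 2 * r ^+ (2 * k)) * n%:R))).
  rewrite [leRHS]expRD; apply: ler_pM; rewrite ?exprn_ge0 ?expR_ge0 //; last by rewrite expRM_natr.
  rewrite size_allpairs natrM.
  (* The finer net [N k.+1] accounts for 4t, because r^2 <= 4, and [N k] for t. *)
  have -> : 5 * t * r ^+ (2 * k) = 4 * t * r ^+ (2 * k) + t * r ^+ (2 * k) by ring.
  rewrite expRD; apply: ler_pM; rewrite ?ler0n //.
    apply: le_trans (sN _) _; rewrite ler_expR (le_trans (epsa _)) //.
    rewrite mulnS exprD mulrA ler_wpM2r ?exprn_ge0 ?(ltW r0) //.
    rewrite [4 * t]mulrC ler_wpM2l //; nra.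
  by apply: le_trans (sN _) _; rewrite ler_expR.
apply: le_trans (hexp k.+3); rewrite ler_expR.
have := r2k k; move: (r ^+ (2 * k)) => X Xk.
have k1 : 0 <= k%:R :> R by rewrite ler0n.
rewrite -[k.+1]addn1 natrD in Xk; rewrite -[k.+3]addn3 natrD.
have X0 : 0 <= X by lra.
have h1 : t * X <= (3 / 64 * n%:R) * X by rewrite ler_wpM2r //; lra.
have h2 : 0 <= (n%:R - 40) * (X - 1) by rewrite mulr_ge0 //; lra.
nra.
Qed.

End chaining.

Lemma powR2_lt2 (x : R) : x < 1 -> 2 `^ x < 2.
Proof.
move=> x1; rewrite /powR pnatr_eq0 /= -[ltRHS]lnK ?posrE // ltr_expR.
by rewrite gtr_pMl // ln_gt0 // ltr1n.
Qed.

Lemma powR2_lt1 (b : R) : 0 < b -> 2 `^ (- b) < 1.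
Proof.
move=> b0; rewrite /powR pnatr_eq0 /= -[ltRHS]expR0 ltr_expR mulNr oppr_lt0.
by rewrite mulr_gt0 // ln_gt0 // ltr1n.
Qed.

Lemma pow2_large (x y : R) : 0 < y -> exists M : nat, x / 2 ^+ M <= y.
Proof.
move=> y0; exists (Num.truncn (x / y)).+1; set M := _.+1.
rewrite ler_pdivrMr ?exprn_gt0 // mulrC -ler_pdivrMr //.
have /ltW := truncnS_gt (x / y); rewrite -/M => /le_trans; apply.
by rewrite -natrX ler_nat ltnW // ltn_expl.
Qed.

Lemma random_kernel K C a : 0 <= C -> a < 2 -> has_nets K C a ->
  exists2 L, 0 < L & forall rho n, 0 < rho -> L * rho `^ (- a) + L <= n%:R ->
    exists2 gs : seq H, size gs = n &
      forall h, K h -> `|h| = rho -> exists2 g, g \in gs & ip h g != 0.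
Proof.
move=> C0 a2 nets.
(* r^2 = 2^max(a,1) dominates both 2^a, for the net sizes, and 2, for summability over levels; r < 2
   because a < 2. *)
pose r : R := 2 `^ (Num.max a 1 / 2).
have r0 : 0 < r by rewrite powR_gt0.
have r2E : r ^+ 2 = 2 `^ (Num.max a 1).
  by rewrite -powR_mulrn ?powR_ge0 // -powRrM divfK.
have r2 : r < 2 by apply: powR2_lt2; rewrite ltr_pdivrMr // mul1r gt_max a2 ltr1n.
have r2a : 2 `^ a <= r ^+ 2 by rewrite r2E ler_powR ?ler1n // le_max lexx.
have r22 : 2 <= r ^+ 2.
  by rewrite r2E -[leLHS]powRr1 // ler_powR ?ler1n // le_max lexx orbT.
(* Makes the increments add up to 9 theta rho / (1 - r/2) = 3/128 rho, half of the level-0 lower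
   bound 3/64 rho; the depth [M] is chosen so that the tail takes the other half. *)
pose theta := 3 / 64 * (1 - r / 2) / 18.
have theta0 : 0 < theta by rewrite /theta; lra.
have theta1 : theta <= 1 / 2 by rewrite /theta; lra.
(* 64/3 = 16 / (3/4), from the condition on [n] in [chain_bound_sum]. *)
pose L := 64 / 3 * (C * theta `^ (- a) + 4).
have L0 : 0 < L.
  by rewrite mulr_gt0 // ltr_wpDl // mulr_ge0 // powR_ge0.
exists L => // rho n rho0 nL.
pose eps k := theta * rho / 2 ^+ k.
have eps0 k : 0 < eps k.
  by apply: divr_gt0; [exact: mulr_gt0|exact: exprn_gt0].
have /choice[N NP] : forall k, exists N : seq H,
    (size N)%:R <= expR (C * eps k `^ (- a)) /\
    forall h, K h -> exists2 z, z \in N & `|h - z| <= eps k.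
  by move=> k; have [N N1 N2] := nets _ (eps0 k); exists N.
have [bs fbs bsN] := frame_exists ip (N 0%N).
have c0 : 0 < 3 / 128 :> R by lra.
have [M MG] := pow2_large (theta * \sum_(b <- bs) `|b|) c0.
have {MG} MG : eps M * \sum_(b <- bs) `|b| <= 3 / 128 * rho.
  have -> : eps M * \sum_(b <- bs) `|b| =
      theta * (\sum_(b <- bs) `|b|) / 2 ^+ M * rho by rewrite /eps; ring.
  by rewrite ler_pM2r.
pose lev k := if k is k'.+1 then [seq x - y | x <- N k'.+1, y <- N k'] else N 0%N.
pose s := [seq (k, w) | k <- iota 0 M.+1, w <- lev k].
have sum1 : \sum_(j <- s) 1 * chain_bound r j ^+ n < 1.
  have nbig : 16 * (C * (theta * rho) `^ (- a) + 4) <= 3 / 4 * n%:R.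
    rewrite powRM ?(ltW theta0) ?(ltW rho0) //; move: nL; rewrite /L.
    rewrite [C * (_ * _)]mulrA.
    have : 0 <= C * theta `^ (- a) by rewrite mulr_ge0 // powR_ge0.
    have := powR_ge0 rho (- a).
    move: (rho `^ (- a)) (C * theta `^ (- a)) => P A P0 A0.
    have := mulr_ge0 A0 P0; lra.
  apply: le_lt_trans (chain_bound_sum rho0 theta0 C0 r0 r2 r2a r22
    (fun k => (NP k).1) nbig M.+1).
  rewrite -(big_mkord xpredT (fun k => (size (lev k))%:R * chain_bound r (k, 0) ^+ n)).
  rewrite /s big_allpairs_dep /index_iota subn0 ler_sum // => k _.
  rewrite (eq_bigr (fun=> chain_bound r (k, 0) ^+ n)) ?sumr_const_seq // => w _.
  by rewrite mul1r.
have [gs [sgs gsb gsP]] := sign_selection (chain_test_ge0 rho theta r bs)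
  (fun=> ler01) (fun j => sign_mean_chain_test r rho0 theta0 j fbs) sum1.
exists gs => // h Kh hrho; apply: contrapT => ngs.
have hg g : g \in gs -> ip h g = 0.
  by move=> ggs; have [//|hgn] := eqVneq (ip h g) 0; case: ngs; exists g.
(* All tests are nonnegative, so a total below 1 bounds each product separately. *)
have {}gsP j : j \in s -> \prod_(g <- gs) chain_test rho theta r bs j g < 1.
  move=> js; apply: le_lt_trans gsP; rewrite -[leLHS]mul1r.
  apply: (@sum_le_term _ _ (fun j => 1 * \prod_(g <- gs) _)) js => i.
  by rewrite mul1r prodr_ge0 // => g _; exact: chain_test_ge0.
have /choice[z zP] : forall k, exists z, z \in N k /\ `|h - z| <= eps k.
  by move=> k; have [z z1 z2] := (NP k).2 h Kh; exists z.
have z0 : rho / 2 <= `|z 0%N|.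
  have := (zP 0%N).2; rewrite /eps expr0 divr1 => hz.
  have := ler_normB (z 0%N) (z 0%N - h); rewrite opprB addrC subrK hrho distrC.
  have : theta * rho <= 1 / 2 * rho by rewrite ler_pM2r.
  lra.
have levs k w : (k < M.+1)%N -> w \in lev k -> (k, w) \in s.
  by move=> kM wk; apply/allpairsPdep; exists k, w; rewrite mem_iota.
have low := chain_test0 rho0 z0 fbs (bsN _ (zP 0%N).1)
  (gsP (0%N, z 0%N) (levs 0%N _ erefl (zP 0%N).1)).
have chain g : g \in gs -> `|ip (z 0%N) g| <=
    \sum_(k < M) `|ip (z k.+1 - z k) g| + 3 / 128 * rho.
  move=> ggs.
  have tel m : `|ip (z 0%N) g| <=
      \sum_(k < m) `|ip (z k.+1 - z k) g| + `|ip (z m) g|.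
    elim: m => [|m IH]; first by rewrite big_ord0 add0r.
    apply: le_trans IH _; rewrite big_ord_recr /= -addrA lerD2l.
    by rewrite ipBl -normrN; have := ler_normB (ip (z m.+1) g - ip (z m) g) (ip (z m.+1) g);
      rewrite addrAC subrr add0r.
  apply: le_trans (tel M) _; rewrite lerD2l; apply: le_trans MG.
  (* Orthogonality of [h] to [g] is used here: the last link of the chain costs only |z M - h|
     |g|. *)
  have -> : ip (z M) g = ip (z M - h) g by rewrite ipBl hg // subr0.
  apply: le_trans (ip_le _ _ _) _; apply: ler_pM => //; last exact: gsb.
  by rewrite distrC; exact: (zP M).2.
have : (size gs)%:R * (3 / 64 * rho) <
   (size gs)%:R * (3 / 128 * rho) + (size gs)%:R * (3 / 128 * rho).
  apply: lt_le_trans low _.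
  apply: (@le_trans _ _ (\sum_(g <- gs)
      (\sum_(k < M) `|ip (z k.+1 - z k) g| + 3 / 128 * rho))).
    by rewrite big_seq [leRHS]big_seq ler_sum // => g; exact: chain.
  rewrite big_split /= sumr_const_seq lerD2r exchange_big /=.
  apply: (@le_trans _ _ (\sum_(k < M) (size gs)%:R * (9 * theta * rho) * (r / 2) ^+ k)).
    apply: ler_sum => k _; apply: (chain_testS (theta := theta) (bs := bs)) => //; last first.
      apply: gsP; apply: levs; first by rewrite ltnS.
      by apply/allpairsPdep; exists (z k.+1), (z k); split; rewrite ?(zP _).1.
    have -> : z k.+1 - z k = (h - z k) - (h - z k.+1) by rewrite opprB [RHS]addrC addrA subrK.
    apply: le_trans (ler_normB _ _) _.
    have := (zP k).2; have := (zP k.+1).2.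
    by rewrite /eps exprS invfM mulrA mulrAC; lra.
  rewrite -mulr_sumr -mulrA ler_wpM2l //.
  have h0 : 0 <= r / 2 by lra.
  have h1 : r / 2 < 1 by lra.
  have t0 : 0 <= 9 * theta * rho by do 2?[apply: mulr_ge0 => //]; exact: ltW.
  apply: le_trans (ler_wpM2l t0 (sum_geo_le M h0 h1)) _.
  rewrite le_eqVlt; apply/orP; left; apply/eqP; rewrite /theta; field.
  by apply/eqP; lra.
by lra.
Qed.

End random_kernel.

(** * Entropy duality and separation *)

Section dual_body.
Context {R : realType} {H F : normedModType R}.
Variables (ip : inner_product H) (u : {linear H -> F}).
Implicit Types (h x z : H) (y : F).

Definition has_op_nets (C a : R) := forall e, 0 < e -> exists2 N : seq F,
  (size N)%:R <= expR (C * e `^ (- a)) &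
  forall x, `|x| <= 1 -> exists2 y, y \in N & `|u x - y| <= e.

(* The image under the adjoint of u of the unit ball of the dual of F. *)
Definition dual_body : set H := [set h | forall x, ip h x <= `|u x|].

Lemma dual_bodyZ h (t : R) : 0 <= t -> t <= 1 -> dual_body h -> dual_body (t *: h).
Proof.
move=> t0 t1 hK x; rewrite ipZl; have := hK x; have := normr_ge0 (u x).
nra.
Qed.

(* For h, h' in the body, |h - h'|^2 <= 2 |u (h - h')|. *)
Lemma dual_body_refine (Z : seq H) (Y : seq F) (e : R) : 0 < e ->
  (forall h, dual_body h -> exists2 z, z \in Z & `|h - z| <= 2 * e) ->
  (forall x, `|x| <= 1 -> exists2 y, y \in Y & `|u x - y| <= e / 8) ->
  exists2 Z' : seq H, size Z' = (size Z * size Y)%N &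
    forall h, dual_body h -> exists2 z, z \in Z' & `|h - z| <= e.
Proof.
move=> e0 ZP YP.
(* One representative is taken per nonempty cell (0 otherwise). Two members of a cell have images
   under [u] at distance at most 2e (e/8 + e/8) = e^2/2. *)
pose cell z y : set H := [set h | [/\ dual_body h, `|h - z| <= 2 * e &
  `|u ((2 * e)^-1 *: (h - z)) - y| <= e / 8]].
exists [seq xget 0 (cell z y) | z <- Z, y <- Y]; first by rewrite size_allpairs.
move=> h hK; have [z zZ hz] := ZP h hK.
have e20 : 0 < 2 * e by lra.
have hz1 : `|(2 * e)^-1 *: (h - z)| <= 1.
  by rewrite normrZ gtr0_norm ?invr_gt0 // ler_pdivrMl // mulr1.
have [y yY hy] := YP _ hz1.
have [] : cell z y (xget 0 (cell z y)) by apply: xgetPex; exists h.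
set h' := xget _ _ => h'K h'z h'y.
exists h'; first by apply/allpairsPdep; exists z, y.
have uhh : `|u (h - h')| <= e ^+ 2 / 2.
  have -> : h - h' = (2 * e) *: ((2 * e)^-1 *: (h - z) - (2 * e)^-1 *: (h' - z)).
    rewrite -scalerBr scalerA divff ?gt_eqF // scale1r.
    by rewrite opprB addrA subrK.
  rewrite linearZ normrZ gtr0_norm // linearB.
  have := ler_normB (u ((2 * e)^-1 *: (h - z)) - y) (u ((2 * e)^-1 *: (h' - z)) - y).
  rewrite opprB addrA subrK; move: (`|_ - _|) => X; nra.
rewrite -(@ler_pXn2r _ 2) ?nnegrE ?(ltW e0) //.
rewrite -(ip_norm ip) ipBl; have := hK (h - h').
have := h'K (h' - h); rewrite -opprB ipNr linearN normrN; lra.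
Qed.

(** Halving the scale repeatedly from radius [c], where {0} is a net because |h|^2 <= |u h| <= c |h|
    on the body. Each halving adds C (e/8)^(-a) to the log-size, a geometric series dominated by its
    last term. *)
Lemma dual_nets (C a c : R) : 0 <= C -> 0 < a -> 0 <= c ->
  (forall x, `|u x| <= c * `|x|) -> has_op_nets C a ->
  exists2 C', 0 <= C' & has_nets dual_body C' a.
Proof.
move=> C0 a0 c0 uc nets.
pose d : R := 2 `^ (- a).
have d0 : 0 < d by rewrite powR_gt0.
have d1 : d < 1 by exact: powR2_lt1.
(* The solution of C' = C' 2^(-a) + C 8^a, so that the recursion reproduces the same bound. *)
pose C' := C * (2 `^ a) ^+ 3 / (1 - d).
have C'0 : 0 <= C' by rewrite divr_ge0 ?mulr_ge0 ?exprn_ge0 ?powR_ge0 //; lra.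
exists C' => // e e0.
have [j] := pow2_large c e0; rewrite ler_pdivrMr ?exprn_gt0 //.
elim: j e e0 => [|j IH] e e0 ce.
  exists [:: 0]; first by rewrite -expR0 ler_expR mulr_ge0 // powR_ge0.
  move=> h hK; exists 0; rewrite ?mem_head // subr0.
  rewrite expr0 mulr1 in ce; apply: le_trans ce.
  have := hK h; rewrite ip_norm => /le_trans /(_ (uc h)).
  by have := normr_ge0 h; nra.
have e20 : 0 < 2 * e by lra.
have [|Z sZ ZP] := IH _ e20; first by rewrite -mulrA mulrCA -exprS.
have e80 : 0 < e / 8 by rewrite divr_gt0.
have [Y sY YP] := nets _ e80.
have [Z' sZ' Z'P] := dual_body_refine e0 ZP YP.
exists Z'; last exact: Z'P.
rewrite sZ' natrM.
have -> : C' * e `^ (- a) = C' * (2 * e) `^ (- a) + C * (e / 8) `^ (- a).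
  have -> : (8 : R) = 2 ^+ 3 by ring.
  rewrite powR_halves ?(ltW e0) // powRM ?(ltW e0) // -/d /C'.
  by field; rewrite subr_eq0 gt_eqF.
by rewrite expRD; apply: ler_pM sZ sY; rewrite ler0n.
Qed.

End dual_body.

Section separation.
Context {R : realType} {H : completeNormedModType R}.
Variables (ip : inner_product H) (N : H -> R) (c : R).
Hypotheses (c0 : 0 < c) (ND : forall x y, N (x + y) <= N x + N y)
  (NZ : forall a x, N (a *: x) <= `|a| * N x) (Nc : forall x, N x <= c * `|x|).
Implicit Types (h p x z : H).

(** Projection onto the convex set where N <= t: the parallelogram law makes a minimising sequence
    Cauchy, and [Nc] makes the set closed. *)
Lemma nearest_point x0 (t : R) : 0 < t -> exists2 p, N p <= t &
  forall z, N z <= t -> `|x0 - p| <= `|x0 - z|.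
Proof.
move=> t0; pose C : set H := [set z | N z <= t].
have N0 : N 0 <= 0 by have := NZ 0 0; rewrite scale0r normr0 mul0r.
pose A := [set `|x0 - z| | z in C].
have Ainf : has_inf A.
  split; first by exists `|x0 - 0|, 0 => //; rewrite /C /= (le_trans N0) // ltW.
  by exists 0 => _ [z _ <-].
set D := inf A.
have DP z : C z -> D <= `|x0 - z| by move=> Cz; apply: ge_inf; [exact: Ainf.2|exists z].
have D0 : 0 <= D by apply: lb_le_inf; [exact: Ainf.1|move=> _ [z _ <-]].
have /choice[z zP] : forall n : nat, exists z, C z /\ `|x0 - z| < D + n.+1%:R^-1.
  move=> n; have n0 : 0 < n.+1%:R^-1 :> R by rewrite invr_gt0.
  by have [_ [z Cz <-] zD] := inf_adherent n0 Ainf; exists z.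
have par n m : `|z n - z m| ^+ 2 <=
   2 * `|x0 - z n| ^+ 2 + 2 * `|x0 - z m| ^+ 2 - 4 * D ^+ 2.
  have Cm : C (2^-1 *: (z n + z m)).
    apply: le_trans (NZ _ _) _; rewrite gtr0_norm //.
    by have := ND (z n) (z m); have := (zP n).1; have := (zP m).1; rewrite /C /=; lra.
  have := DP _ Cm; rewrite -(@ler_pXn2r _ 2) ?nnegrE // => h.
  have e1 : x0 - 2^-1 *: (z n + z m) = 2^-1 *: ((x0 - z n) + (x0 - z m)).
    rewrite addrACA -opprD scalerBr; congr (_ - _).
    by rewrite -mulr2n -[x0 *+ 2]scaler_nat scalerA mulVf ?scale1r // pnatr_eq0.
  have e2 : z n - z m = (x0 - z m) - (x0 - z n) by rewrite opprB [RHS]addrC addrA subrK.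
  rewrite e1 normrZ gtr0_norm // exprMn in h; rewrite e2.
  move: h; move: (x0 - z n) (x0 - z m) => a b.
  by rewrite -!(ip_norm ip) !(ipDl, ipDr, ipNl, ipNr) [ip b a]ipC; lra.
have cz : cvg (z @ \oo).
  apply: cauchy_cvg; apply: cauchy_exP => e e0.
  have e20 : 0 < e ^+ 2 by rewrite exprn_gt0.
  pose n := Num.truncn (4 * (2 * D + 1) / e ^+ 2).
  have nP : 4 * (2 * D + 1) * n.+1%:R^-1 < e ^+ 2.
    by rewrite ltr_pdivrMr // -ltr_pdivrMl // mulrC truncnS_gt.
  exists (z n); exists n => // m /= nm.
  rewrite -ball_normE /= -(@ltr_pXn2r _ 2) ?nnegrE ?(ltW e0) //.
  apply: le_lt_trans (par n m) _; apply: le_lt_trans nP.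
  have m1 : m.+1%:R^-1 <= n.+1%:R^-1 :> R by rewrite lef_pV2 ?posrE // ler_nat.
  have n1 : n.+1%:R^-1 <= 1 :> R by rewrite invf_le1 // ler1n.
  have n0 : 0 < n.+1%:R^-1 :> R by rewrite invr_gt0.
  have := (zP n).2; have := (zP m).2.
  have := normr_ge0 (x0 - z n); have := normr_ge0 (x0 - z m).
  move: (n.+1%:R^-1) (m.+1%:R^-1) (`|_|) (`|_|) m1 n1 n0 => d d' X Y m1 n1 n0 X0 Y0 XD YD.
  have X2 : X ^+ 2 <= (D + d) ^+ 2 by rewrite ler_pXn2r ?nnegrE //; lra.
  have Y2 : Y ^+ 2 <= (D + d) ^+ 2 by rewrite ler_pXn2r ?nnegrE //; lra.
  nra.
have zlim (e : R) : 0 < e -> exists n, `|lim (z @ \oo) - z n| < e /\ n.+1%:R^-1 < e.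
  move=> e0; have /cvgrPdist_lt/(_ e e0)[n _ nP] := cz.
  pose m := maxn n (Num.truncn e^-1); exists m; split.
    by apply: nP; rewrite /= leq_maxl.
  rewrite invf_plt ?posrE //; apply: lt_le_trans (truncnS_gt _) _.
  by rewrite ler_nat ltnS leq_maxr.
exists (lim (z @ \oo)).
  apply/ler_addgt0Pr => e; move: (e : R) => {}e e0; have ec0 : 0 < e / c by rewrite divr_gt0.
  have [n [nz _]] := zlim _ ec0.
  have := ND (z n) (lim (z @ \oo) - z n); rewrite addrC subrK => /le_trans; apply.
  apply: lerD; first exact: (zP n).1.
  by apply: le_trans (Nc _) _; rewrite mulrC -ler_pdivlMr // ltW.
move=> w /DP; apply: le_trans; apply/ler_addgt0Pr => e; move: (e : R) => {}e e0.
have e20 : 0 < e / 2 by rewrite divr_gt0.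
have [n [nz nd]] := zlim _ e20.
have := ler_normB (x0 - z n) (lim (z @ \oo) - z n).
rewrite opprB addrA subrK; move: (zP n).2 => h1 /le_trans; apply.
apply/ltW/(lt_trans (ltrD h1 nz)).
by rewrite -addrA ltrD2l [ltRHS]splitr ltrD2r.
Qed.

(** The normal [x0 - p] at the nearest point [p], rescaled to take the value [t] at [p], is bounded
    by [t] where N <= t, hence by N everywhere by homogeneity. *)
Lemma seminorm_separation x0 (t : R) : 0 < t -> t < N x0 ->
  exists2 h, forall x, ip h x <= N x & t < ip h x0.
Proof.
move=> t0 tx0; have [p Np pP] := nearest_point x0 t0.
set h := x0 - p in pP.
have h0 : h != 0.
  by apply: contraTneq tx0 => /subr0_eq ->; rewrite -leNgt.
have hn : 0 < `|h| by rewrite normr_gt0.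
have var z : N z <= t -> ip h z <= ip h p.
  move=> Nz; rewrite -subr_le0 -ipBr leNgt; apply/negP => q0.
  set w := z - p in q0; set q := ip h w in q0.
  (* With this step length, moving from [p] towards [z] changes the squared distance by -2lq +
     l^2|w|^2 < 0, against minimality. *)
  pose l := Num.min 1 (q / (`|w| ^+ 2 + 1)).
  have w0 : 0 < `|w| ^+ 2 + 1 by rewrite ltr_wpDl // sqr_ge0.
  have l0 : 0 < l by rewrite lt_min ltr01 divr_gt0.
  have l1 : l <= 1 by rewrite ge_min lexx.
  have lq : l * (`|w| ^+ 2 + 1) <= q by rewrite -ler_pdivlMr // ge_min lexx orbT.
  have := pP (p + l *: w) _.
  have -> : N (p + l *: w) <= t.
    have -> : p + l *: w = (1 - l) *: p + l *: z.
      by rewrite scalerBr scalerBl scale1r addrA addrAC.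
    apply: le_trans (ND _ _) _.
    have := NZ (1 - l) p; have := NZ l z.
    rewrite !ger0_norm ?subr_ge0 // ?(ltW l0) //; nra.
  move=> /(_ isT); rewrite opprD addrA -/h.
  rewrite -(@ler_pXn2r _ 2) ?nnegrE // (normB_sqr ip h) ipZr normrZ exprMn.
  rewrite (ger0_norm (ltW l0)) -/q; have := sqr_ge0 `|w|; nra.
(* The set where N <= t contains a small positive multiple of [h], to which [var] applies. *)
have s0 : 0 < ip h p.
  apply: lt_le_trans (var ((t / (c * `|h|)) *: h) _).
    by rewrite ipZr ip_norm mulr_gt0 ?divr_gt0 ?mulr_gt0 ?exprn_gt0.
  apply: le_trans (Nc _) _; rewrite normrZ gtr0_norm ?divr_gt0 ?mulr_gt0 //.
  by rewrite le_eqVlt; apply/orP; left; apply/eqP; field; rewrite !gt_eqF.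
set s := ip h p in var s0.
have ht z : N z <= t -> ip ((t / s) *: h) z <= t.
  move=> /var hz; rewrite ipZl -mulrA [s^-1 * _]mulrC mulrA ler_pdivrMr //.
  by rewrite ler_pM2l.
exists ((t / s) *: h); last first.
  rewrite ipZl -[x0](subrK p) ipDr -/h ip_norm -/s mulrDr.
  rewrite divfK ?gt_eqF // ltrDr mulr_gt0 ?divr_gt0 ?exprn_gt0 //.
move=> x; set h' := _ *: h.
have Nx0 : 0 <= N x.
  have := ND x (- x); rewrite subrr -scaleN1r; have := NZ (- 1) x.
  rewrite normrN1 mul1r; have := ND 0 0; rewrite addr0; lra.
have [Nx|Nx] := eqVneq (N x) 0.
  rewrite Nx leNgt; apply/negP => q0.
  have := ht ((2 * t / ip h' x) *: x); rewrite ipZr divfK ?gt_eqF // => /(_ _) h2.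
  have : 2 * t <= t by apply: h2; apply: le_trans (NZ _ _) _; rewrite Nx mulr0 ltW.
  lra.
have Nxp : 0 < N x by rewrite lt0r Nx.
have := ht ((t / N x) *: x); rewrite ipZr mulrAC ler_pdivrMr // ler_pM2l //; apply.
by apply: le_trans (NZ _ _) _; rewrite gtr0_norm ?divr_gt0 // divfK.
Qed.

End separation.

(** * Entropy and Kolmogorov numbers *)

Section spans.
Context {R : realType} {F : normedModType R}.
Implicit Types (y z : F).

Lemma lin_span0 k (v : 'I_k -> F) : lin_span v 0.
Proof. by exists (fun=> 0) => //; rewrite big1 // => i _; rewrite scale0r. Qed.

Lemma lin_spanD k (v : 'I_k -> F) y z :
  lin_span v y -> lin_span v z -> lin_span v (y + z).
Proof.
move=> [c _ <-] [d _ <-]; exists (fun i => c i + d i) => //.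
by rewrite -big_split; apply: eq_bigr => i _; rewrite scalerDl.
Qed.

Lemma lin_spanZ k (v : 'I_k -> F) (a : R) y :
  lin_span v y -> lin_span v (a *: y).
Proof.
move=> [c _ <-]; exists (fun i => a * c i) => //.
by rewrite scaler_sumr; apply: eq_bigr => i _; rewrite scalerA.
Qed.

Lemma lin_span_mem k (v : 'I_k -> F) i : lin_span v (v i).
Proof.
exists (fun j => (j == i)%:R) => //; rewrite (bigD1 i) //= eqxx scale1r big1 ?addr0 //.
by move=> j /negPf ->; rewrite scale0r.
Qed.

Lemma lin_span_sub k l (v : 'I_k -> F) (w : 'I_l -> F) :
  (forall i, lin_span w (v i)) -> lin_span v `<=` lin_span w.
Proof.
move=> vw _ [c _ <-]; elim/big_ind: _ => [|y z|i _].
- exact: lin_span0.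
- exact: lin_spanD.
- by apply: lin_spanZ; exact: vw.
Qed.

(** Constructions produce arbitrary families, whereas Kolmogorov numbers ask for a basis: a vector
    with a nonzero coefficient in a relation is dropped. *)
Lemma lin_span_dim n (v : 'I_n -> F) :
  exists2 k, (k <= n)%N & is_subspace_dim (lin_span v) k.
Proof.
elim: n v => [|n IH] v; first by exists 0%N => //; exists v => // c _ [].
have [vi|/existsNP[c /not_implyP[c0 /existsNP[i /eqP ci]]]] := pselect (lin_indep v).
  by exists n.+1 => //; exists v.
have [k kn [w wi wE]] := IH (v \o lift i).
exists k; first exact: leqW.
exists w => //; rewrite -wE; apply/seteqP; split; apply: lin_span_sub => j.
  case: (unliftP i j) => [l ->|->]; first exact: (lin_span_mem (v \o lift i)).
  have -> : v i = - (c i)^-1 *: \sum_(j < n) c (lift i j) *: v (lift i j).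
    move: c0; rewrite (bigD1_ord i) //= => /eqP; rewrite addr_eq0 => /eqP h.
    by rewrite scaleNr -scalerN -h scalerA mulVf // scale1r.
  apply: lin_spanZ; exists (fun j => c (lift i j)) => //.
exact: lin_span_mem.
Qed.

Lemma quotient_norm_has_inf k (v : 'I_k -> F) y :
  has_inf [set `|y - z| | z in lin_span v].
Proof.
split; first by exists `|y - 0|, 0 => //; exact: lin_span0.
by exists 0 => _ [z _ <-].
Qed.

Lemma quotient_norm_le k (v : 'I_k -> F) y z :
  lin_span v z -> quotient_norm (lin_span v) y <= `|y - z|.
Proof.
by move=> vz; apply: ge_inf; [exact: (quotient_norm_has_inf v y).2|exists z].
Qed.

Lemma quotient_norm_ge0 k (v : 'I_k -> F) y : 0 <= quotient_norm (lin_span v) y.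
Proof.
apply: lb_le_inf; first exact: (quotient_norm_has_inf v y).1.
by move=> _ [z _ <-].
Qed.

Lemma quotient_norm_near k (v : 'I_k -> F) y (e : R) : 0 < e ->
  exists2 z, lin_span v z & `|y - z| < quotient_norm (lin_span v) y + e.
Proof.
by move=> /inf_adherent/(_ (quotient_norm_has_inf v y))[_ [z vz <-] h]; exists z.
Qed.

Lemma quotient_normD k (v : 'I_k -> F) y z :
  quotient_norm (lin_span v) (y + z) <=
  quotient_norm (lin_span v) y + quotient_norm (lin_span v) z.
Proof.
apply/ler_addgt0Pr => e; move: (e : R) => {}e e0.
have e20 : 0 < e / 2 by rewrite divr_gt0.
have [y' vy hy] := quotient_norm_near v y e20.
have [z' vz hz] := quotient_norm_near v z e20.
apply: le_trans (quotient_norm_le _ (lin_spanD vy vz)) _.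
rewrite opprD addrACA; apply: le_trans (ler_normD _ _) _.
by apply: le_trans (lerD (ltW hy) (ltW hz)) _; rewrite addrACA -splitr.
Qed.

Lemma quotient_normZ k (v : 'I_k -> F) (a : R) y :
  quotient_norm (lin_span v) (a *: y) <= `|a| * quotient_norm (lin_span v) y.
Proof.
apply/ler_addgt0Pr => e; move: (e : R) => {}e e0.
have d0 : 0 < e / (`|a| + 1) by rewrite divr_gt0 // ltr_wpDl.
have [y' vy hy] := quotient_norm_near v y d0.
apply: le_trans (quotient_norm_le _ (lin_spanZ a vy)) _.
rewrite -scalerBr normrZ; apply: le_trans (ler_wpM2l (normr_ge0 a) (ltW hy)) _.
rewrite mulrDr lerD2l mulrA ler_pdivrMr ?ltr_wpDl //.
by rewrite mulrC ler_pM2l // lerDl.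
Qed.

End spans.

Section numbers.
Context {R : realType} {E F : normedModType R}.
Variables (u : {linear E -> F}) (c : R).
Hypotheses (c0 : 0 < c) (uc : forall x, `|u x| <= c * `|x|).
Implicit Types (n : nat) (x : E) (y z : F) (e : R).

Lemma unit_ballE x : unit_ball x = (`|x| <= 1) :> Prop.
Proof. by rewrite /unit_ball /closed_ball_ /= sub0r normrN. Qed.

Lemma unit_ball_le x : `|x| <= 1 -> `|u x| <= c.
Proof. by move=> x1; apply: le_trans (uc x) _; rewrite ger_pMr. Qed.

Definition covered (N : seq F) e :=
  forall x, `|x| <= 1 -> exists2 y, y \in N & `|u x - y| <= e.

Lemma entropy_number_has_inf n : has_inf [set eps : R | 0 < eps /\
  exists x : 'I_(2 ^ n.-1) -> F,
    u @` @unit_ball R E `<=` \bigcup_i closed_ball_ Num.norm (x i) eps].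
Proof.
split; last by exists 0 => x [/ltW].
exists c; split=> //; exists (fun=> 0) => _ [x /[!unit_ballE] x1 <-].
have i0 : 'I_(2 ^ n.-1) by exists 0%N; rewrite expn_gt0.
by exists i0 => //; rewrite /closed_ball_ /= sub0r normrN unit_ball_le.
Qed.

Lemma entropy_number_ge0 n : 0 <= entropy_number u n.
Proof.
by apply: lb_le_inf; [exact: (entropy_number_has_inf n).1|move=> x [/ltW]].
Qed.

Lemma entropy_number_lt n e : entropy_number u n < e ->
  exists2 N : seq F, size N = (2 ^ n.-1)%N & covered N e.
Proof.
have Ainf := entropy_number_has_inf n.
rewrite /entropy_number; set A := (X in inf X) in Ainf * => Ae.
have e0 : 0 < e - inf A by rewrite subr_gt0.
have [d [d0 [v vP]] de] := inf_adherent e0 Ainf.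
rewrite subrKC in de.
exists (codom v); first by rewrite size_codom card_ord.
move=> x x1; have [|i _ ix] := vP (u x); first by exists x; rewrite ?unit_ballE.
exists (v i); first exact: codom_f.
by rewrite distrC (le_trans ix) // ltW.
Qed.

Lemma entropy_number_le n e (N : seq F) : 0 < e ->
  (size N <= 2 ^ n.-1)%N -> covered N e -> entropy_number u n <= e.
Proof.
move=> e0 sN NP; apply: ge_inf; first by exists 0 => x [/ltW].
split=> //; exists (fun i => nth 0 N i) => _ [x /[!unit_ballE] x1 <-].
have [y yN xy] := NP x x1.
have iN : (index y N < 2 ^ n.-1)%N by rewrite (leq_trans _ sN) // index_mem.
by exists (Ordinal iN) => //; rewrite /closed_ball_ /= nth_index // distrC.
Qed.

Definition spanned n e := exists v : 'I_n -> F,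
  forall x, `|x| <= 1 -> exists2 z, lin_span v z & `|u x - z| <= e.

Lemma quotient_op_norm_ub k (v : 'I_k -> F) :
  has_ubound [set quotient_norm (lin_span v) (u x) | x in @unit_ball R E].
Proof.
exists c => _ [x /[!unit_ballE] x1 <-].
by apply: le_trans (quotient_norm_le _ (lin_span0 v)) _; rewrite subr0 unit_ball_le.
Qed.

Lemma quotient_op_norm_ge0 k (v : 'I_k -> F) : 0 <= quotient_op_norm (lin_span v) u.
Proof.
apply: le_trans (quotient_norm_ge0 v (u 0)) _; apply: ub_le_sup.
  exact: quotient_op_norm_ub.
by exists 0 => //; rewrite unit_ballE normr0.
Qed.

Lemma kolmogorov_number_lt n e : (0 < n)%N -> kolmogorov_number u n < e ->
  spanned n e.
Proof.
move=> n0; rewrite /kolmogorov_number; set A := (X in inf X) => Ae.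
have Ainf : has_inf A.
  split.
    exists (quotient_op_norm (lin_span (fun _ : 'I_0 => 0)) u).
    exists (lin_span (fun _ : 'I_0 => 0)) => //; exists 0%N => //.
    by exists (fun=> 0) => // ? _ [].
  by exists 0 => _ [_ [k _ [v _ ->]] <-]; exact: quotient_op_norm_ge0.
have e0 : 0 < e - inf A by rewrite subr_gt0.
have [_ [_ [k kn [v _ ->]] <-]] := inf_adherent e0 Ainf.
rewrite subrKC => ve.
(* The subspace has dimension k < n; its basis is padded with zeros to n vectors. *)
exists (fun i => if insub (val i) is Some j then v j else 0) => x x1.
have : quotient_norm (lin_span v) (u x) < e.
  apply: le_lt_trans ve; apply: ub_le_sup; first exact: quotient_op_norm_ub.
  by exists x; rewrite ?unit_ballE.
move=> qe; have d0 : 0 < e - quotient_norm (lin_span v) (u x) by rewrite subr_gt0.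
have [z vz hz] := quotient_norm_near v (u x) d0.
rewrite subrKC in hz; exists z; last exact: ltW.
move: z vz {hz}; apply: lin_span_sub => i.
have -> : v i = (fun i : 'I_n => if insub (val i) is Some j then v j else 0)
    (widen_ord (ltnW kn) i) by rewrite /= valK.
exact: lin_span_mem.
Qed.

Lemma kolmogorov_number_le n e (v : 'I_n -> F) :
  (forall x, `|x| <= 1 -> quotient_norm (lin_span v) (u x) <= e) ->
  kolmogorov_number u n.+1 <= e.
Proof.
move=> ve; have [k kn kv] := lin_span_dim v.
apply: (@le_trans _ _ (quotient_op_norm (lin_span v) u)).
  apply: ge_inf; last by exists (lin_span v) => //; exists k.
  by exists 0 => _ [_ [l _ [w _ ->]] <-]; exact: quotient_op_norm_ge0.
apply: ge_sup; last by move=> _ [x /[!unit_ballE] x1 <-]; exact: ve.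
by exists (quotient_norm (lin_span v) (u 0)), 0 => //; rewrite unit_ballE normr0.
Qed.

Lemma kolmogorov_number_le_norm n : (0 < n)%N -> kolmogorov_number u n <= c.
Proof.
case: n => // n _; apply: (@kolmogorov_number_le n c (fun=> 0)) => x x1.
apply: le_trans (quotient_norm_le _ (lin_span0 _)) _.
by rewrite subr0 unit_ball_le.
Qed.

Lemma kolmogorov_number_ge0 n : (0 < n)%N -> 0 <= kolmogorov_number u n.
Proof.
move=> n0; apply: lb_le_inf.
  exists (quotient_op_norm (lin_span (fun _ : 'I_0 => 0)) u).
  exists (lin_span (fun _ : 'I_0 => 0)) => //; exists 0%N => //.
  by exists (fun=> 0) => // ? _ [].
by move=> _ [_ [k _ [v _ ->]] <-]; exact: quotient_op_norm_ge0.
Qed.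

Lemma entropy_nets (C a : R) : 0 < C -> 0 < a ->
  (forall n, (1 <= n)%N -> entropy_number u n <= C * n%:R `^ (- a^-1)) ->
  has_op_nets u (C `^ a) a.
Proof.
(* X is where C X^(-1/a) = e. As [m.-1] is the truncation of X, the 2^(m-1) centres number at most
   exp(X). *)
move=> C0 a0 eC e e0; pose X := (C / e) `^ a.
have X0 : 0 <= X by exact: powR_ge0.
pose m := (Num.truncn X).+1.
have mX : X < m%:R by exact: truncnS_gt.
have me : entropy_number u m < e.
  apply: le_lt_trans (eC m isT) _.
  rewrite powRN ltr_pdivrMr ?powR_gt0 // -ltr_pdivrMl // mulrC.
  have -> : C / e = X `^ a^-1.
    by rewrite /X -powRrM divff ?gt_eqF // powRr1 // ltW // divr_gt0.
  by rewrite gt0_ltr_powR ?invr_gt0 ?nnegrE.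
have [N sN NP] := entropy_number_lt me.
exists N => //; rewrite sN /m /= natrX.
have -> : C `^ a * e `^ (- a) = X.
  by rewrite /X powRM ?invr_ge0 ?ltW // -[e^-1]powR_inv1 ?ltW // -powRrM mulN1r.
apply: (@le_trans _ _ (expR (Num.truncn X)%:R)).
  rewrite -[(Num.truncn X)%:R]mulr1 expRM_natl lerXn2r ?nnegrE ?expR_ge0 //.
  by have := @expR_ge1Dx R 1; lra.
by rewrite ler_expR truncn_le.
Qed.

End numbers.

Section kolmogorov_from_entropy.
Context {R : realType} {H : completeNormedModType R} {F : normedModType R}.
Variables (ip : inner_product H) (u : {linear H -> F}) (c : R).
Hypotheses (c0 : 0 < c) (uc : forall x, `|u x| <= c * `|x|).

(* In place of the Hahn-Banach theorem: if the distance to the span of the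
   u g_i exceeded rho at some x in the unit ball, separation would produce an
   element of the dual body of norm > rho orthogonal to all the g_i. *)
Lemma orthogonal_quotient_norm (gs : seq H) (rho : R) : 0 < rho ->
  (forall h, dual_body ip u h -> `|h| = rho -> exists2 g, g \in gs & ip h g != 0) ->
  forall x, `|x| <= 1 ->
    quotient_norm (lin_span (fun i : 'I_(size gs) => u (tnth (in_tuple gs) i))) (u x)
    <= rho.
Proof.
move=> rho0 gsP x x1; set v := fun i => _; rewrite leNgt; apply/negP => xrho.
pose N z := quotient_norm (lin_span v) (u z).
have [|||h hN hx] := @seminorm_separation R H ip N c c0 _ _ _ x rho rho0 xrho.
- by move=> y z; rewrite /N linearD quotient_normD.
- by move=> a z; rewrite /N linearZ quotient_normZ.
- move=> z; apply: le_trans (quotient_norm_le _ (lin_span0 v)) _.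
  by rewrite subr0.
have hK : dual_body ip u h.
  move=> z; apply: le_trans (hN z) _.
  by apply: le_trans (quotient_norm_le _ (lin_span0 v)) _; rewrite subr0.
have hg g : g \in gs -> ip h g = 0.
  move=> ggs; have [i gi] : exists i, u g = v i.
    have /tnthP[i ->] : g \in in_tuple gs by [].
    by exists i.
  have N0 a : N (a *: g) = 0.
    apply/eqP; rewrite eq_le quotient_norm_ge0 andbT.
    rewrite /N linearZ gi; apply: le_trans (quotient_norm_le _ (lin_spanZ a (lin_span_mem v i))) _.
    by rewrite subrr normr0.
  apply/eqP; rewrite eq_le; apply/andP; split.
    by rewrite -(N0 1) scale1r hN.
  by have := hN (- 1 *: g); rewrite N0 ipZr mulN1r oppr_le0.
have hrho : rho < `|h|.
  apply: lt_le_trans hx _; apply: le_trans (ler_norm _) _.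
  by apply: le_trans (ip_le _ _ _) _; rewrite ler_piMr.
have h0 : 0 < `|h| by exact: lt_trans hrho.
(* The dual body is star-shaped about 0, so [h] can be shrunk to norm exactly [rho]. *)
have [||g ggs] := gsP ((rho / `|h|) *: h).
- apply: dual_bodyZ hK; first by apply: divr_ge0; exact: ltW.
  by rewrite ler_pdivrMr // mul1r ltW.
- by rewrite normrZ gtr0_norm ?divr_gt0 // divfK ?gt_eqF.
by rewrite ipZl hg // mulr0 eqxx.
Qed.

Lemma kolmogorov_from_entropy (C a : R) : 0 < C -> 0 < a -> a < 2 ->
  (forall n, (1 <= n)%N -> entropy_number u n <= C * n%:R `^ (- a^-1)) ->
  exists2 C', 0 < C' &
  forall n, (1 <= n)%N -> kolmogorov_number u n <= C' * n%:R `^ (- a^-1).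
Proof.
move=> C0 a0 a2 eC.
have [K K0 nets] := dual_nets ip (powR_ge0 C a) a0 (ltW c0) uc (entropy_nets c0 uc C0 a0 eC).
have [L L0 LP] := random_kernel ip K0 a2 nets.
have ia0 : 0 < a^-1 by rewrite invr_gt0.
pose C' := Num.max ((4 * L) `^ a^-1) (c * (2 * L + 1) `^ a^-1).
have C'0 : 0 < C' by rewrite lt_max powR_gt0 // mulr_gt0.
exists C' => // -[//|n] _.
rewrite powRN ler_pdivlMr ?powR_gt0 ?ltr0n //.
have [nL|nL] := ltP n%:R (2 * L).
  apply: (@le_trans _ _ (c * (2 * L + 1) `^ a^-1)); last by rewrite le_max lexx orbT.
  apply: ler_pM; rewrite ?powR_ge0 ?(kolmogorov_number_ge0 c0 uc) //.
    exact: kolmogorov_number_le_norm.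
  apply: ge0_ler_powR; rewrite ?nnegrE ?ler0n ?(ltW ia0) //.
    by lra.
  by rewrite -[n.+1%:R]natr1 lerD2r ltW.
have n0 : 0 < n%:R :> R by lra.
(* Gives L rho^(-a) = n/2, and the remaining [L] is at most n/2. The n vectors bound the Kolmogorov
   number of index n + 1, and n + 1 <= 2n turns 2L into 4L. *)
pose rho := (n%:R / (2 * L)) `^ (- a^-1).
have X0 : 0 < n%:R / (2 * L) by rewrite divr_gt0 ?mulr_gt0.
have rho0 : 0 < rho by exact: powR_gt0.
have rhoa : rho `^ (- a) = n%:R / (2 * L).
  by rewrite /rho -powRrM mulrNN mulVf ?gt_eqF // powRr1 // ltW.
have [|gs sgs gsP] := LP rho n rho0.
  have -> : L * rho `^ (- a) = n%:R / 2 by rewrite rhoa; field; rewrite gt_eqF.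
  lra.
have := kolmogorov_number_le c0 uc (orthogonal_quotient_norm rho0 gsP).
rewrite sgs => drho.
apply: (@le_trans _ _ ((4 * L) `^ a^-1)); last by rewrite le_max lexx.
apply: (@le_trans _ _ (rho * n.+1%:R `^ a^-1)).
  by rewrite ler_wpM2r // powR_ge0.
rewrite /rho powRN mulrC ler_pdivrMr ?powR_gt0 // -powRM ?(ltW X0) ?mulr_ge0 ?(ltW L0) //.
have -> : 4 * L * (n%:R / (2 * L)) = 2 * n%:R by field; rewrite gt_eqF.
apply: ge0_ler_powR; rewrite ?nnegrE ?(ltW ia0) ?mulr_ge0 ?ler0n //.
by rewrite -natrM ler_nat mul2n -addnn -addn1 leq_add2l -(ltr0n R).
Qed.

End kolmogorov_from_entropy.

(** * Carl's inequality *)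

Section lattice_counting.
Context {R : realType} {F : normedModType R}.
Variables (k : nat) (v : 'I_k -> F).

Definition lattice_point (eta : R) (z : 'I_k -> R) : F :=
  eta *: \sum_(l < k) z l *: v l.

Lemma lattice_pointD eta z w :
  lattice_point eta (fun l => z l + w l) = lattice_point eta z + lattice_point eta w.
Proof.
rewrite /lattice_point -scalerDr -big_split; congr (_ *: _).
by apply: eq_bigr => l _; rewrite scalerDl.
Qed.

Lemma lattice_pointZ eta (t : R) z :
  lattice_point eta (fun l => t * z l) = t *: lattice_point eta z.
Proof.
rewrite /lattice_point scalerA mulrC -scalerA; congr (_ *: _).
by rewrite scaler_sumr; apply: eq_bigr => l _; rewrite scalerA.
Qed.

Lemma lattice_point_le eta z (t : R) : 0 <= eta -> (forall l, `|z l| <= t) ->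
  `|lattice_point eta z| <= t * (eta * \sum_(l < k) `|v l|).
Proof.
move=> eta0 zt; rewrite normrZ ger0_norm // mulrCA ler_wpM2l //.
rewrite mulr_sumr; apply: le_trans (ler_norm_sum _ _ _) _; apply: ler_sum => l _.
by rewrite normrZ ler_wpM2r.
Qed.

(* Volume comparison by counting: translates of the lattice points in a small
   ball by the separated points are disjoint and lie in a large ball, while
   dividing coordinates by 2^j maps the large ball into the small one with
   fibres of size at most 2^(j k).  Bounded boxes of coordinates make all
   counts finite without assuming the v_l independent. *)
Lemma separated_card n (x : 'I_n -> F) j (delta : R) :
  0 < delta -> delta <= 1 -> 16 <= 2 ^+ j * delta ->
  (forall i, lin_span v (x i)) -> (forall i, `|x i| <= 1) ->
  (forall i i', i != i' -> delta < `|x i - x i'|) ->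
  (n <= 2 ^ (j * k))%N.
Proof.
move=> d0 d1 jd vx x1 sep.
have /choice[c cP] : forall i, exists c, \sum_(l < k) c l *: v l = x i.
  by move=> i; have [c _ cE] := vx i; exists c.
pose V := \sum_(l < k) `|v l|.
have V0 : 0 <= V by apply: sumr_ge0.
(* Mesh so fine that an error of at most 1 in every coordinate moves a point by at most delta/8. *)
pose eta := delta / (8 * (V + 1)).
have eta0 : 0 < eta by rewrite divr_gt0 // mulr_gt0 // ltr_wpDl.
have etaV : eta * V <= delta / 8.
  rewrite /eta mulrAC ler_pdivrMr ?mulr_gt0 ?ltr_wpDl //.
  rewrite mulrA divfK ?pnatr_eq0 // ler_pM2l //; lra.
pose m := (Num.truncn (\sum_(i < n) \sum_(l < k) `|c i l / eta|)).+1.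
have cm i l : `|c i l / eta| <= m%:R.
  apply: le_trans (ltW (truncnS_gt _)).
  rewrite (bigD1 i) //= (bigD1 l) //= -addrA lerDl addr_ge0 ?sumr_ge0 //.
  by move=> i' _; apply: sumr_ge0.
pose J := (2 ^ j)%N.
have J0 : (0 < J)%N by rewrite expn_gt0.
have jdJ : 16 <= J%:R * delta by rewrite /J natrX.
have J1 : (1 <= J.-1)%N.
  suff : (2 <= J)%N by lia.
  by rewrite -(ler_nat R); have : 0 <= J%:R :> R by []; nra.
have JmE : (J * m = J.-1 * m + m)%N by rewrite -mulSnr prednK.
pose Y i l := Num.truncn (c i l / eta + (J.-1 * m)%:R).
have cY i l : - (J.-1 * m)%:R <= c i l / eta <= (J.-1 * m)%:R.
  rewrite -ler_norml; apply: le_trans (cm i l) _.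
  by rewrite ler_nat leq_pmull.
have Yle i l : (Y i l <= 2 * (J.-1 * m))%N.
  rewrite /Y truncn_le_nat -addn1 natrD mul2n -addnn natrD.
  by have /andP[_] := cY i l; lra.
have Yap i l : `|(Y i l)%:R - (J.-1 * m)%:R - c i l / eta| <= 1.
  have /truncn_itv/andP[] : 0 <= c i l / eta + (J.-1 * m)%:R.
    by have /andP[] := cY i l; lra.
  rewrite -/(Y i l) -natr1 => h1 h2; apply/ler_normlP; split; lra.
pose B : finType := {ffun 'I_k -> 'I_(2 * m).+1}.
pose A : finType := {ffun 'I_k -> 'I_((2 * m).+1 * J)}.
pose pB (b : B) := lattice_point eta (fun l => (b l)%:R - m%:R).
pose pA (a : A) := lattice_point eta (fun l => (a l)%:R - (J * m)%:R).
(* Translates of the small ball are disjoint, since 2 (delta/4 + delta/8) < delta, and stay within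
   radius 2. Division by J sends radius 2 to at most 2/J + delta/8 <= delta/4, because J delta >=
   16. *)
pose small := [set b : B | `|pB b| <= delta / 4]%SET.
pose big := [set a : A | `|pA a| <= 2]%SET.
pose X i := lattice_point eta (fun l => (Y i l)%:R - (J.-1 * m)%:R).
have xE i : x i = lattice_point eta (fun l => c i l / eta).
  rewrite /lattice_point -cP scaler_sumr; apply: eq_bigr => l _.
  by rewrite scalerA mulrC divfK ?gt_eqF.
have Xx i : `|X i - x i| <= delta / 8.
  have -> : X i - x i = lattice_point eta
      (fun l => (Y i l)%:R - (J.-1 * m)%:R + (- 1) * (c i l / eta)).
    by rewrite lattice_pointD lattice_pointZ -xE scaleN1r.
  apply: le_trans (lattice_point_le (ltW eta0) (t := 1) _) _; last by rewrite mul1r.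
  by move=> l; rewrite mulN1r.
have fb i (b : B) l : (Y i l + b l < (2 * m).+1 * J)%N.
  have := ltn_ord (b l); have := Yle i l; rewrite -{2}(prednK J0).
  move: (J.-1) (Y i l) => p y; nia.
pose f (ib : 'I_n * B) : A := [ffun l => Ordinal (fb ib.1 ib.2 l)].
have fE i b : pA (f (i, b)) = X i + pB b.
  rewrite -lattice_pointD; congr lattice_point; apply/funext => l.
  by rewrite ffunE /= JmE !natrD; ring.
have ga1 (a : A) l : (a l %/ J < (2 * m).+1)%N.
  by rewrite ltn_divLR // ltn_ord.
have ga2 (a : A) l : (a l %% J < J)%N by rewrite ltn_mod.
pose g (a : A) : B * {ffun 'I_k -> 'I_J} :=
  ([ffun l => Ordinal (ga1 a l)], [ffun l => Ordinal (ga2 a l)]).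
have JR : 0 < J%:R :> R by rewrite ltr0n.
have gE a : pB (g a).1 = J%:R^-1 *: (pA a - lattice_point eta (fun l => (a l %% J)%:R)).
  rewrite -scaleN1r -lattice_pointZ -lattice_pointD -lattice_pointZ.
  congr lattice_point; apply/funext => l; rewrite ffunE /=.
  rewrite [in RHS](divn_eq (a l) J) modnMDl modn_mod natrD !natrM; field.
  by rewrite gt_eqF.
have small0 : (0 < #|small|)%N.
  apply/card_gt0P; exists [ffun=> inord m]; rewrite inE /pB /lattice_point big1 => [|l _].
    by rewrite scaler0 normr0 divr_ge0 // ltW.
  by rewrite ffunE inordK ?subrr ?scale0r //; lia.
have le1 : (n * #|small| <= #|big|)%N.
  rewrite -[n in leqLHS]card_ord -cardsT -cardsX -(@card_in_imset _ _ f).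
    apply/subset_leq_card/fintype.subsetP => _ /imsetP[[i b] /setXP[_ bs] ->].
    rewrite inE fE; rewrite inE in bs.
    have -> : X i + pB b = x i + ((X i - x i) + pB b) by rewrite addrA [x i + _]addrC subrK.
    apply: le_trans (ler_normD _ _) _; apply: le_trans (lerD (x1 i) (ler_normD _ _)) _.
    by have := Xx i; move: bs; lra.
  move=> [i b] [i' b'] /setXP[_ bs] /setXP[_ bs'] fbb.
  rewrite !inE in bs bs'.
  have ii : i = i'.
    apply/eqP/contraT => /sep; have := fE i b; rewrite fbb fE => XX.
    have -> : x i - x i' = (pB b' - pB b) + ((X i' - x i') - (X i - x i)).
      have -> : pB b' = X i + pB b - X i' by rewrite -XX addrC addKr.
      by rewrite [X i + _ - _ - _]addrAC addrK opprB addrA subrKA addrC subrKA.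
    rewrite ltNge => /negP[]; apply: le_trans (ler_normD _ _) _.
    apply: le_trans (lerD (ler_normB _ _) (ler_normB _ _)) _.
    by have := Xx i; have := Xx i'; lra.
  rewrite ii in fbb *; congr pair; apply/ffunP => l; apply: val_inj.
  by have /ffunP/(_ l) := fbb; rewrite !ffunE => /(congr1 val)/addnI.
have le2 : (#|big| <= #|small| * J ^ k)%N.
  have -> : (J ^ k = #|[set: {ffun 'I_k -> 'I_J}]%SET|)%N by rewrite cardsT card_ffun !card_ord.
  rewrite -cardsX -(@card_in_imset _ _ g).
    apply/subset_leq_card/fintype.subsetP => _ /imsetP[a ab ->]; apply/setXP; rewrite !inE.
    split=> //; rewrite gE; rewrite inE in ab.
    rewrite normrZ gtr0_norm ?invr_gt0 // ler_pdivrMl //.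
    apply: le_trans (ler_normB _ _) _.
    have := lattice_point_le (z := fun l => (a l %% J)%:R) (t := J%:R) (ltW eta0).
    move=> /(_ _)/le_trans h; apply: le_trans (lerD ab (h _ _ _)) _.
      by move=> l; rewrite ger0_norm // ler_nat ltnW.
      by apply: ler_wpM2l etaV.
    by lra.
  move=> a a' _ _ [/ffunP q /ffunP r]; apply/ffunP => l; apply: val_inj => /=.
  have := q l; have := r l; rewrite !ffunE => -[rl] [ql].
  by rewrite (divn_eq (a l) J) ql rl -divn_eq.
by have := leq_trans le1 le2; rewrite mulnC leq_pmul2l // expnM.
Qed.

(** A maximal delta-separated family is a delta-net; [separated_card] guarantees that a maximal one
    exists. *)
Lemma ball_net j (delta : R) : 0 < delta -> delta <= 1 -> 16 <= 2 ^+ j * delta ->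
  exists2 N : seq F, (size N <= 2 ^ (j * k))%N &
    forall y, lin_span v y -> `|y| <= 1 -> exists2 z, z \in N & `|y - z| <= delta.
Proof.
move=> d0 d1 jd.
pose P n := `[< exists x : 'I_n -> F, [/\ forall i, lin_span v (x i),
  forall i, `|x i| <= 1 & forall i i', i != i' -> delta < `|x i - x i'|] >].
have P0 : exists n, P n by exists 0%N; apply/asboolP; exists (fun=> 0); split=> -[].
have Pb n : P n -> (n <= 2 ^ (j * k))%N.
  by move=> /asboolP[x [x1 x2 x3]]; exact: separated_card x3.
have [n /asboolP[x [xv xn xd]] nmax] := ex_maxnP P0 Pb.
exists (codom x).
  by rewrite size_codom card_ord; apply: Pb; apply/asboolP; exists x.
move=> y vy y1; apply: contrapT => /forall2NP far.
have far' i : delta < `|y - x i|.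
  by have [/negP|/negP] := far (x i); rewrite ?codom_f // -ltNge.
suff /nmax : P n.+1 by rewrite ltnn.
pose x' i := if unlift ord0 i is Some l then x l else y.
have x'0 : x' ord0 = y by rewrite /x' unlift_none.
have x'S i : x' (lift ord0 i) = x i by rewrite /x' liftK.
apply/asboolP; exists x'; split.
- by move=> i; case: (unliftP ord0 i) => [l ->|->]; rewrite ?x'S ?x'0.
- by move=> i; case: (unliftP ord0 i) => [l ->|->]; rewrite ?x'S ?x'0.
move=> i i'; case: (unliftP ord0 i) => [l ->|->]; case: (unliftP ord0 i') => [l' ->|->];
  rewrite ?x'S ?x'0 ?eqxx //.
- by move=> ll; apply: xd; apply: contraNneq ll => ->.
- by move=> _; rewrite distrC.
Qed.

Lemma scaled_ball_net j (delta r : R) : 0 < delta -> delta <= 1 ->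
  16 <= 2 ^+ j * delta -> 0 < r ->
  exists2 N : seq F, (size N <= 2 ^ (j * k))%N &
    forall y, lin_span v y -> `|y| <= r -> exists2 z, z \in N & `|y - z| <= r * delta.
Proof.
move=> d0 d1 jd r0; have [N sN NP] := ball_net d0 d1 jd.
exists [seq r *: z | z <- N]; first by rewrite size_map.
move=> y vy yr; have [||z zN zy] := NP (r^-1 *: y).
- exact: lin_spanZ.
- by rewrite normrZ gtr0_norm ?invr_gt0 // ler_pdivrMl // mulr1.
exists (r *: z); first exact: map_f.
have -> : y - r *: z = r *: (r^-1 *: y - z).
  by rewrite scalerBr scalerA divff ?gt_eqF // scale1r.
by rewrite normrZ gtr0_norm // ler_pM2l.
Qed.

End lattice_counting.

Section carl.
Context {R : realType} {E F : normedModType R}.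
Variable u : {linear E -> F}.

(** Differences of approximants at consecutive levels lie in spans of dimension about 2^i. They are
    discretised more finely the coarser the level: this costs about 2^i (N - i) b bits, which sum to
    O(2^N), and keeps the accumulated error comparable to that of level N. *)
Lemma carl_chain (A tau : R) b N : 0 < A -> 0 < tau -> tau <= 1 -> 2 <= 2 ^+ b * tau ->
  (forall x, `|x| <= 1 -> `|u x| <= A) ->
  (forall j, (j <= N)%N -> spanned u (2 ^ j) (A * tau ^+ j)) ->
  exists2 Y : seq F, (size Y <= 2 ^ (2 ^ N * (4 * b + 16)))%N &
    covered u Y (A * tau ^+ N * (1 + 4 / tau)).
Proof.
move=> A0 t0 t1 bt uA sp.
have step i : (i <= N)%N -> forall (v : 'I_(2 ^ i) -> F),
    (forall x, `|x| <= 1 -> exists2 z, lin_span v z & `|u x - z| <= A * tau ^+ i) ->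
    exists2 Y : seq F, (size Y <= 2 ^ (2 ^ i.+1 * (2 * b * (N - i) + 2 * b + 8)))%N &
    forall x, `|x| <= 1 -> forall z, lin_span v z -> `|u x - z| <= A * tau ^+ i ->
      exists2 y, y \in Y & `|z - y| <= 4 / tau * A * tau ^+ i / 2 ^+ ((N - i) * b).
  elim: i => [|i IH] iN v vP.
    have d0 : 0 < (2 ^+ (N * b))^-1 :> R by rewrite invr_gt0 exprn_gt0.
    have d1 : (2 ^+ (N * b))^-1 <= 1 :> R.
      by rewrite invf_le1 ?exprn_gt0 // exprn_ege1 // ler1n.
    have jd : 16 <= 2 ^+ (N * b + 4) * (2 ^+ (N * b))^-1 :> R.
      by rewrite exprD mulrAC divff ?mul1r ?gt_eqF ?exprn_gt0 // -natrX ler_nat.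
    have A20 : 0 < 2 * A by rewrite mulr_gt0.
    have [Y sY YP] := scaled_ball_net v d0 d1 jd A20.
    exists Y.
      apply: leq_trans sY _; rewrite leq_exp2l // expn0 muln1 subn0 expn1; nia.
    move=> x x1 z vz xz; have [|y yY zy] := YP z vz.
      have := ler_normB (u x) (u x - z); rewrite opprB addrC subrK.
      move: xz; rewrite expr0 mulr1; have := uA x x1; lra.
    exists y => //; apply: le_trans zy _.
    rewrite subn0 expr0 mulr1 ler_wpM2r // ?(ltW d0) // ler_wpM2r ?(ltW A0) //.
    by rewrite ler_pdivlMr //; lra.
  have [w wP] := sp i (ltnW iN).
  have [Y sY YP] := IH (ltnW iN) w wP.
  set q := (N - i.+1)%N.
  have qE : (N - i = q.+1)%N by rewrite /q -subSn.
  (* Both families together, so that [z - z'] lies in a single span. *)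
  pose vw (l : 'I_(2 ^ i.+1 + 2 ^ i)) := match fintype.split l with inl a => v a | inr a => w a end.
  have d0 : 0 < (2 ^+ (q * b))^-1 :> R by rewrite invr_gt0 exprn_gt0.
  have d1 : (2 ^+ (q * b))^-1 <= 1 :> R.
    by rewrite invf_le1 ?exprn_gt0 // exprn_ege1 // ler1n.
  have jd : 16 <= 2 ^+ (q * b + 4) * (2 ^+ (q * b))^-1 :> R.
    by rewrite exprD mulrAC divff ?mul1r ?gt_eqF ?exprn_gt0 // -natrX ler_nat.
  have r0 : 0 < 2 * (A * tau ^+ i) by rewrite !mulr_gt0 // exprn_gt0.
  have [D sD DP] := scaled_ball_net vw d0 d1 jd r0.
  exists [seq y + d | y <- Y, d <- D].
    rewrite size_allpairs; apply: leq_trans (leq_mul sY sD) _.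
    rewrite -expnD leq_exp2l // qE !expnS.
    by move: (2 ^ i)%N => P; nia.
  move=> x x1 z vz xz; have [z' wz' xz'] := wP x x1.
  have [y yY zy] := YP x x1 z' wz' xz'.
  have [||d dD zd] := DP (z - z').
  - apply: lin_spanD.
      move: z vz {xz}; apply: lin_span_sub => l.
      have -> : v l = vw (lshift _ l) by rewrite /vw -[lshift _ l]/(unsplit (inl l)) unsplitK.
      exact: lin_span_mem.
    rewrite -scaleN1r; apply: lin_spanZ; move: z' wz' {xz' zy}; apply: lin_span_sub => l.
    have -> : w l = vw (rshift _ l) by rewrite /vw -[rshift _ l]/(unsplit (inr l)) unsplitK.
    exact: lin_span_mem.
  - have := ler_normB (u x - z') (u x - z); rewrite opprB addrC subrKA distrC.
    have : A * tau ^+ i.+1 <= A * tau ^+ i.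
      by rewrite exprS ler_wpM2l ?(ltW A0) // ler_piMl // exprn_ge0 // ltW.
    move: xz xz'; lra.
  exists (y + d); first by apply/allpairsPdep; exists y, d.
  have -> : z - (y + d) = (z' - y) + ((z - z') - d).
    by rewrite addrA [z' - y + _]addrC subrKA opprD addrA.
  apply: le_trans (ler_normD _ _) _; apply: le_trans (lerD zy zd) _.
  rewrite qE mulSn exprD exprSr.
  (* The inherited error is halved by [2 <= 2 ^+ b * tau]; the new net contributes the other
     half. *)
  have h : (2 ^+ b * tau)^-1 <= 1 / 2.
    by rewrite div1r lef_pV2 ?posrE ?mulr_gt0 ?exprn_gt0.
  have AT0 : 0 <= 4 * A * tau ^+ i * (2 ^+ (q * b))^-1.
    by rewrite !mulr_ge0 ?(ltW A0) ?exprn_ge0 ?(ltW t0) ?(ltW d0).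
  have -> : 4 / tau * A * tau ^+ i / (2 ^+ b * 2 ^+ (q * b)) =
      4 * A * tau ^+ i * (2 ^+ (q * b))^-1 * (2 ^+ b * tau)^-1.
    by field; rewrite !gt_eqF ?exprn_gt0.
  have -> : 4 / tau * A * (tau ^+ i * tau) / 2 ^+ (q * b) =
      4 * A * tau ^+ i * (2 ^+ (q * b))^-1.
    by field; rewrite !gt_eqF ?exprn_gt0.
  have := ler_wpM2l AT0 h; lra.
have [v vP] := sp N (leqnn N).
have [Y sY YP] := step N (leqnn N) v vP.
exists Y.
  apply: leq_trans sY _; rewrite leq_exp2l // subnn expnS.
  by move: (2 ^ N)%N => P; nia.
move=> x x1; have [z vz xz] := vP x x1.
have [y yY zy] := YP x x1 z vz xz; exists y => //.
have -> : u x - y = (u x - z) + (z - y) by rewrite addrA subrK.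
apply: le_trans (ler_normD _ _) _; apply: le_trans (lerD xz zy) _.
rewrite subnn mul0n expr0 divr1 le_eqVlt; apply/orP; left; apply/eqP; field.
by rewrite gt_eqF.
Qed.

End carl.

Section carl_rates.
Context {R : realType} {E F : normedModType R}.
Variables (u : {linear E -> F}) (c : R).
Hypotheses (c0 : 0 < c) (uc : forall x, `|u x| <= c * `|x|).

Lemma powR_exp2 (b : R) k : (2 ^+ k) `^ b = (2 `^ b) ^+ k.
Proof.
elim: k => [|k IH]; first by rewrite !expr0 powR1.
by rewrite !exprS powRM ?exprn_ge0 // IH.
Qed.

Lemma spanned_mono n m (e d : R) : (n <= m)%N -> e <= d ->
  spanned u n e -> spanned u m d.
Proof.
move=> nm ed [v vP]; exists (fun i => if insub (val i) is Some j then v j else 0).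
move=> x x1; have [z vz xz] := vP x x1; exists z; last exact: le_trans ed.
move: z vz {xz}; apply: lin_span_sub => i.
have -> : v i = (fun i : 'I_m => if insub (val i) is Some j then v j else 0)
    (widen_ord nm i) by rewrite /= valK.
exact: lin_span_mem.
Qed.

Lemma entropy_number_le_norm n : entropy_number u n <= c.
Proof.
apply: (@entropy_number_le _ _ _ u n c [:: 0]) => //=; first by rewrite expn_gt0.
by move=> x x1; exists 0; rewrite ?mem_head // subr0 unit_ball_le.
Qed.

(** [M] and [K] are chosen before [A] and [N]; the lower bound on Kolmogorov numbers applies this
    with an [A] that varies with the index. *)
Lemma carl_entropy (b : R) : 0 < b -> exists M : nat, exists2 K : R, 0 < K &
  forall (A : R) N, 0 < A -> (forall x, `|x| <= 1 -> `|u x| <= A) ->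
  (forall j, (j <= N)%N -> spanned u (2 ^ j) (A * (2 `^ (- b)) ^+ j)) ->
  forall m, (M.+1 * 2 ^ N < m)%N -> entropy_number u m <= K * A * (2 `^ (- b)) ^+ N.
Proof.
move=> b0; set tau := 2 `^ (- b).
have t0 : 0 < tau by rewrite powR_gt0.
have t1 : tau <= 1 by rewrite ltW // powR2_lt1.
have [l lP] := pow2_large 2 t0.
have bt : 2 <= 2 ^+ l * tau by rewrite mulrC -ler_pdivrMr // exprn_gt0.
exists (4 * l + 15)%N; exists (1 + 4 / tau).
  by rewrite addr_gt0 // divr_gt0.
move=> A N A0 uA sp m Mm.
have [Y sY YP] := carl_chain A0 t0 t1 bt uA sp.
have e0 : 0 < A * tau ^+ N * (1 + 4 / tau).
  by rewrite !mulr_gt0 ?exprn_gt0 // addr_gt0 // divr_gt0.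
rewrite -mulrA [_ * (A * _)]mulrC; apply: entropy_number_le e0 _ YP.
apply: leq_trans sY _; rewrite leq_exp2l // mulnC addnS.
by case: m Mm.
Qed.

(** The added [c] makes the inequality strict, as [kolmogorov_number_lt] demands, and makes the
    leading constant dominate |u| on the unit ball. *)
Lemma spanned_dyadic (C a : R) :
  (forall n, (1 <= n)%N -> kolmogorov_number u n <= C * n%:R `^ (- a^-1)) ->
  forall j, spanned u (2 ^ j) ((C + c) * (2 `^ (- a^-1)) ^+ j).
Proof.
move=> dC j; apply: (kolmogorov_number_lt c0 uc); first by rewrite expn_gt0.
apply: le_lt_trans (dC _ _) _; first by rewrite expn_gt0.
by rewrite natrX powR_exp2 ltr_pM2r ?ltrDl // exprn_gt0 // powR_gt0.
Qed.

Lemma entropy_from_kolmogorov (C a : R) : 0 < C -> 0 < a ->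
  (forall n, (1 <= n)%N -> kolmogorov_number u n <= C * n%:R `^ (- a^-1)) ->
  exists2 C', 0 < C' &
  forall n, (1 <= n)%N -> entropy_number u n <= C' * n%:R `^ (- a^-1).
Proof.
move=> C0 a0 dC.
have ia0 : 0 < a^-1 by rewrite invr_gt0.
have [M [K K0 MP]] := carl_entropy ia0.
set tau := 2 `^ _ in MP.
pose A := C + c; have A0 : 0 < A by rewrite addr_gt0.
have uA x : `|x| <= 1 -> `|u x| <= A.
  by move=> x1; apply: le_trans (unit_ball_le c0 uc x1) _; rewrite lerDr ltW.
pose C' := Num.max (c * M.+1%:R `^ a^-1) (K * A * (2 * M.+1)%:R `^ a^-1).
have C'0 : 0 < C' by rewrite lt_max mulr_gt0 // powR_gt0.
exists C' => // n n1.
rewrite powRN ler_pdivlMr ?powR_gt0 ?ltr0n //.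
have [nM|nM] := leqP n M.+1.
  apply: (@le_trans _ _ (c * M.+1%:R `^ a^-1)); last by rewrite le_max lexx.
  apply: le_trans (ler_wpM2r (powR_ge0 _ _) (entropy_number_le_norm n)) _.
  rewrite ler_pM2l //.
  by apply: ge0_ler_powR; rewrite ?nnegrE ?ler0n ?(ltW ia0) // ler_nat.
(* N is the largest exponent with M.+1 2^N < n, so n <= 2 M.+1 2^N. *)
pose q := (n.-1 %/ M.+1)%N.
have q0 : (0 < q)%N by rewrite divn_gt0 // -ltnS prednK.
pose N := trunc_log 2 q.
have Nlo : (M.+1 * 2 ^ N < n)%N.
  rewrite -[ltnRHS](prednK n1) ltnS mulnC -leq_divRL //; exact: trunc_logP.
have Nhi : (n <= 2 * M.+1 * 2 ^ N)%N.
  have := trunc_log_ltn q (isT : (1 < 2)%N); rewrite -/N /q ltn_divLR // expnS.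
  by rewrite -[in n in _ -> (n <= _)%N](prednK n1); move: (2 ^ N)%N => P; nia.
have e1 := MP A N A0 uA (fun j _ => spanned_dyadic dC j) n Nlo.
apply: (@le_trans _ _ (K * A * (2 * M.+1)%:R `^ a^-1)); last by rewrite le_max lexx orbT.
apply: le_trans (ler_wpM2r (powR_ge0 _ _) e1) _.
rewrite -[leLHS]mulrA ler_pM2l ?mulr_gt0 //.
rewrite /tau -powR_exp2 powRN ler_pdivrMl ?powR_gt0 ?exprn_gt0 // -powRM ?exprn_ge0 //.
apply: ge0_ler_powR; rewrite ?nnegrE ?mulr_ge0 ?exprn_ge0 ?ler0n ?(ltW ia0) //.
by rewrite -natrX -natrM ler_nat mulnC.
Qed.

Lemma kolmogorov_lower_bound (C c1 a : R) : 0 < C -> 0 < c1 -> 0 < a ->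
  (forall n, (1 <= n)%N -> kolmogorov_number u n <= C * n%:R `^ (- a^-1)) ->
  (forall n, (1 <= n)%N -> c1 * n%:R `^ (- a^-1) <= entropy_number u n) ->
  exists2 c2, 0 < c2 &
  forall n, (1 <= n)%N -> c2 * n%:R `^ (- a^-1) <= kolmogorov_number u n.
Proof.
move=> C0 c10 a0 dC ec.
have ia0 : 0 < a^-1 by rewrite invr_gt0.
have b0 : 0 < a^-1 *+ 2 by rewrite mulrn_wgt0.
have [M [K K0 MP]] := carl_entropy b0.
set tau : R := 2 `^ (- a^-1).
have tau2 : 2 `^ (- (a^-1 *+ 2)) = tau ^+ 2.
  by rewrite /tau -powR_mulrn ?powR_ge0 // -powRrM mulNr mulr_natr.
rewrite tau2 in MP.
have t0 : 0 < tau by rewrite powR_gt0.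
have t1 : tau < 1 by exact: powR2_lt1.
pose A := C + c; have A0 : 0 < A by rewrite addr_gt0.
pose y := c1 * M.+2%:R `^ (- a^-1).
have y0 : 0 < y by rewrite mulr_gt0 // powR_gt0.
(* k does not depend on n; K A tau^k is the factor by which Carl's bound at scale s + k misses the
   rate tau^(s + k). *)
have [k kP] : exists k, K * A * tau ^+ k < y.
  have [k] := pow2_large ((2 * K * A / y) `^ a) ltr01.
  rewrite ler_pdivrMr ?exprn_gt0 // mul1r => kP; exists k.
  have Y0 : 0 < 2 * K * A / y by rewrite divr_gt0 ?mulr_gt0.
  have : 2 * K * A / y <= (2 ^+ k) `^ a^-1.
    have <- : ((2 * K * A / y) `^ a) `^ a^-1 = 2 * K * A / y.
      by rewrite -powRrM divff ?lt0r_neq0 // powRr1 // ltW.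
    by apply: ge0_ler_powR; rewrite ?nnegrE ?powR_ge0 ?exprn_ge0 ?(ltW ia0).
  rewrite ler_pdivrMr // => h.
  rewrite /tau -powR_exp2 powRN ltr_pdivrMr ?powR_gt0 ?exprn_gt0 //.
  apply: lt_le_trans (_ : _ < 2 * K * A) _; last by rewrite [leRHS]mulrC.
  by rewrite -mulrA ltr_pMl ?mulr_gt0 // ltr1n.
exists (A * tau ^+ (2 * k).+1); first by rewrite mulr_gt0 ?exprn_gt0.
move=> n n1; rewrite leNgt; apply/negP => dn.
have spn := kolmogorov_number_lt c0 uc n1 dn.
pose s := (trunc_log 2 n).+1.
have ns : (n < 2 ^ s)%N by exact: trunc_log_ltn.
have sn : (2 ^ s.-1 <= n)%N by exact: trunc_logP.
have nt : n%:R `^ (- a^-1) <= tau ^+ s.-1.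
  rewrite -powR_exp2 !powRN lef_pV2 ?posrE ?powR_gt0 ?exprn_gt0 ?ltr0n //.
  by apply: ge0_ler_powR; rewrite ?nnegrE ?exprn_ge0 ?ler0n ?(ltW ia0) // -natrX ler_nat.
have As0 : 0 < A / tau ^+ s by rewrite divr_gt0 // exprn_gt0.
(* Up to level s the known rate suffices, as tau^j <= tau^(2j - s). Beyond it the n vectors of [spn]
   are reused; the worst level s + k asks for tau^(s + 2k), which is what the exponent 2k + 1
   together with [nt] provides. *)
have sp j : (j <= s + k)%N -> spanned u (2 ^ j) (A / tau ^+ s * (tau ^+ 2) ^+ j).
  move=> jsk; have [js|js] := leqP j s.
    apply: spanned_mono (leqnn _) _ (spanned_dyadic dC j).
    rewrite -mulrA ler_pM2l // ler_pdivlMl ?exprn_gt0 //.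
    rewrite -exprM mul2n -addnn exprD ler_pM2r ?exprn_gt0 //.
    by rewrite ler_wiXn2l // ltW.
  apply: spanned_mono _ _ spn; first by rewrite (leq_trans (ltnW ns)) // leq_exp2l // ltnW.
  apply: (@le_trans _ _ (A * tau ^+ (2 * k).+1 * tau ^+ s.-1)).
    by rewrite ler_wpM2l // mulr_ge0 ?exprn_ge0 // ltW.
  rewrite -!mulrA ler_pM2l // ler_pdivlMl ?exprn_gt0 // -exprM -!exprD.
  apply: ler_wiXn2l; [exact: ltW|exact: ltW|].
  by rewrite addSnnS addnCA addnn -mul2n -mulnDr addnC leq_mul2l.
have uA x : `|x| <= 1 -> `|u x| <= A / tau ^+ s.
  move=> x1; apply: le_trans (unit_ball_le c0 uc x1) _.
  rewrite ler_pdivlMr ?exprn_gt0 //; apply: (@le_trans _ _ c).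
    by rewrite ler_piMr ?(ltW c0) // exprn_ile1 // ltW.
  by rewrite lerDr ltW.
have := MP _ _ As0 uA sp (M.+1 * 2 ^ (s + k)).+1 (ltnSn _).
rewrite leNgt => /negP; apply.
apply: lt_le_trans (ec _ _) => //.
have -> : K * (A / tau ^+ s) * (tau ^+ 2) ^+ (s + k) = (K * A * tau ^+ k) * tau ^+ (s + k).
  have -> : (tau ^+ 2) ^+ (s + k) = tau ^+ s * tau ^+ k * tau ^+ (s + k).
    by rewrite -exprD -exprD addnn -exprM mul2n.
  by field; rewrite gt_eqF ?exprn_gt0.
apply: (@lt_le_trans _ _ (y * tau ^+ (s + k))).
  by rewrite ltr_pM2r // exprn_gt0.
rewrite /y -mulrA ler_pM2l // -powR_exp2 -powRM ?exprn_ge0 //.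
rewrite !powRN lef_pV2 ?posrE ?powR_gt0 ?mulr_gt0 ?exprn_gt0 ?ltr0n //.
apply: ge0_ler_powR; rewrite ?nnegrE ?mulr_ge0 ?exprn_ge0 ?ler0n ?(ltW ia0) //.
rewrite -natrX -natrM ler_nat [leqRHS]mulSn -add1n leq_add2r expn_gt0 //.
Qed.

End carl_rates.

(** * Inclusions of Lebesgue spaces *)

Section operators.
Context {R : realType} {E F G : normedModType R}.

Lemma linear_le_of_ball (u : {linear E -> F}) (c : R) :
  (forall x, `|x| <= 1 -> `|u x| <= c) -> forall x, `|u x| <= c * `|x|.
Proof.
move=> uc x; have [->|x0] := eqVneq x 0; first by rewrite linear0 !normr0 mulr0.
have nx : 0 < `|x| by rewrite normr_gt0.
have := uc (`|x|^-1 *: x); rewrite linearZ !normrZ gtr0_norm ?invr_gt0 //.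
rewrite mulVf ?gt_eqF // lexx => /(_ isT).
by rewrite ler_pdivrMl // mulrC.
Qed.

Lemma compact_op_bounded (u : {linear E -> F}) : compact_op u ->
  exists2 c, 0 < c & forall x, `|u x| <= c * `|x|.
Proof.
rewrite /compact_op precompactE => /compact_bounded/pinfty_ex_gt0[c c0 uc].
exists c => //; apply: linear_le_of_ball => x x1; apply: uc.
by apply: subset_closure; exists x; rewrite ?unit_ballE.
Qed.

Lemma entropy_number_comp (u : {linear E -> F}) (w : {linear F -> G})
    (v : {linear E -> G}) (c C : R) n : 0 < c -> (forall x, `|u x| <= c * `|x|) ->
  0 < C -> (forall y, `|w y| <= C * `|y|) -> (forall x, v x = w (u x)) ->
  entropy_number v n <= C * entropy_number u n.
Proof.
move=> c0 uc C0 wC vE; apply/ler_addgt0Pr => e; move: (e : R) => {}e e0.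
have eC0 : 0 < e / C by rewrite divr_gt0.
have [|N sN NP] := @entropy_number_lt _ _ _ u c c0 uc n (entropy_number u n + e / C).
  by rewrite ltrDl.
have r0 : 0 < entropy_number u n + e / C by rewrite ltr_wpDl // (entropy_number_ge0 c0 uc).
have -> : C * entropy_number u n + e = C * (entropy_number u n + e / C).
  by field; rewrite gt_eqF.
apply: (@entropy_number_le _ _ _ v n _ (map w N)); first by rewrite mulr_gt0.
  by rewrite size_map sN.
move=> x x1; have [y yN xy] := NP x x1; exists (w y); first exact: map_f.
by rewrite vE -linearB; apply: le_trans (wC _) _; rewrite ler_pM2l.
Qed.

End operators.

Section Lspace_inclusion.
Context d (T : measurableType d) (R : realType).
Variable mu : {finite_measure set T -> \bar R}.

(** Pointwise |f|^r <= 1 + |f|^p for finite p, and |f| <= 1 almost everywhere for p infinite; a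
    crude constant is enough. *)
Lemma integral_powR_le (f : T -> R) (r : R) (p : \bar R) :
  measurable_fun setT f -> 1 <= r -> (r%:E <= p)%E ->
  ('N[mu]_p [EFin \o f] <= 1)%E ->
  (\int[mu]_x (`|(f x)%:E| `^ r) <= mu setT + 1)%E.
Proof.
move=> mf r1 rp fp; have r0 : 0 < r by apply: lt_le_trans r1.
have mfr (s : R) : measurable_fun setT (fun x => (`|(f x)%:E| `^ s)%E).
  apply: (measurableT_comp (measurable_poweR _)) => //.
  by apply: measurableT_comp => //; exact/measurable_EFinP.
have int1 : (\int[mu]_x (cst 1%E x) = mu setT)%E by rewrite integral_cst // mul1e.
have small x : `|f x| <= 1 -> `|f x| `^ r <= 1.
  move=> fx; have <- : 1 `^ r = 1 :> R by rewrite powR1.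
  by apply: ge0_ler_powR; rewrite ?nnegrE // ltW.
case: p rp fp => [s rs fs|_ fp|//].
  rewrite lee_fin in rs.
  have s0 : 0 < s by apply: lt_le_trans rs.
  apply: (@le_trans _ _ (\int[mu]_x (cst 1%E x + `|(f x)%:E| `^ s))%E).
    apply: ge0_le_integral => //.
    - by move=> x _; exact: poweR_ge0.
    - by apply: emeasurable_funD => //; exact: mfr.
    move=> x _ /=; rewrite -EFinD lee_fin.
    have [fx|/ltW fx] := leP `|f x| 1.
      by apply: le_trans (small _ fx) _; rewrite lerDl powR_ge0.
    by apply: le_trans (ler_powR fx rs) _; rewrite lerDr.
  rewrite ge0_integralD //; last by move=> x _; exact: poweR_ge0.
  rewrite int1 leeD2l // -(poweR_Lnorm mu (EFin \o f)) ?gt_eqF //.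
  rewrite -(poweR1r s); apply: gt0_ler_poweR; rewrite ?in_itv /= ?leey ?Lnorm_ge0 ?lee01 //.
  exact: ltW.
apply: (@le_trans _ _ (\int[mu]_x (cst 1%E x))%E); last by rewrite int1 leeDl.
apply: ae_ge0_le_integral => //.
- by move=> x _; exact: poweR_ge0.
have aef : \forall x \ae mu, (`|(f x)%:E| <= 1)%E.
  (* The infinity norm is an essential supremum only for nonzero measures, so the null measure is
     treated apart. *)
  have [mu0|mu0] := eqVneq (mu setT) 0%E.
    by exists setT; split.
  have mup : (0 < mu setT)%E by rewrite lt0e mu0 measure_ge0.
  by move: fp; rewrite unlock /Lnorm mup => /ess_supP.
by apply: filterS aef => x fx _; rewrite lee_fin; apply: small; rewrite -lee_fin.
Qed.

Lemma Lspace_incl_bounded (p q : \bar R) (p1 : (1 <= p)%E) (q1 : (1 <= q)%E)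
    (qp : (q <= p)%E) :
  exists2 C : R, 0 < C & forall x : LspaceType mu p1,
    `|Lspace_incl q1 qp x| <= C * `|x|.
Proof.
have nE (x : LspaceType mu p1) :
    `|Lspace_incl q1 qp x| = fine ('N[mu]_q [EFin \o (x : T -> R)])%E.
  rewrite [LHS]Lspace_norm_class; congr fine.
suff [C C0 CP] : exists2 C : R, 0 < C & forall x : LspaceType mu p1,
    `|x| <= 1 -> `|Lspace_incl q1 qp x| <= C.
  by exists C => // x; exact: linear_le_of_ball.
have finN (x : LspaceType mu p1) :
   'N[mu]_p [EFin \o (x : T -> R)]%E = (`|x|)%:E.
  exact: (esym (finite_norm_fine (Lspace_repr x))).
have muT : mu setT \is a fin_num by exact: fin_num_measure.
case: q q1 qp nE => [r| |] q1 qp nE //; last first.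
  exists 1 => // x x1; rewrite nE.
  by move: p p1 qp x x1 {nE finN} => [s| |] // p1 qp x x1.
exists (fine ((mu setT + 1) `^ r^-1)%E + 1).
  by rewrite ltr_wpDl // fine_ge0 // poweR_ge0.
move=> x x1; rewrite nE.
have h := @integral_powR_le x r p (Lspace_measurable x) q1 qp.
have {}h : (\int[mu]_t (`|(x t)%:E| `^ r) <= mu setT + 1)%E.
  by apply: h; rewrite finN lee_fin.
have r0 : 0 < r by rewrite -lte_fin (lt_le_trans _ q1).
have fT : ((mu setT + 1) `^ r^-1)%E \is a fin_num.
  by rewrite fin_num_poweR // fin_numD muT.
have : ('N[mu]_(r%:E) [EFin \o (x : T -> R)] <= (mu setT + 1) `^ r^-1)%E.
  rewrite unlock /Lnorm; apply: gt0_ler_poweR h.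
  - by rewrite invr_ge0 ltW.
  - by rewrite in_itv /= leey andbT integral_ge0 // => t _; exact: poweR_ge0.
  - by rewrite in_itv /= leey andbT adde_ge0.
rewrite -[X in (_ <= X)%E](fineK fT); move: ('N[mu]_(_) [_])%E => [y| |] //=.
  by rewrite lee_fin => /le_trans; apply; rewrite lerDl.
by rewrite ler_wpDl // fine_ge0 // poweR_ge0.
Qed.

End Lspace_inclusion.

Definition inner_of_dot (R : realType) (H : normedModType R)
    (dot : {dot H for idfun}) (dot_norm : forall x : H, dot x x = `|x| ^+ 2) :
  inner_product H.
Proof.
apply: (@InnerProduct R H dot) => [x y z|a x y|x y|x].
- exact: linearDl.
- exact: linearZl_LR.
- by rewrite hermC expr0 mul1r.
- exact: dot_norm.
Defined.

Lemma Lspace_incl_trans d (T : measurableType d) (R : realType)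
    (mu : {finite_measure set T -> \bar R}) (p q r : \bar R)
    (p1 : (1 <= p)%E) (q1 : (1 <= q)%E) (r1 : (1 <= r)%E)
    (qp : (q <= p)%E) (rq : (r <= q)%E) (rp : (r <= p)%E)
    (x : LspaceType mu p1) :
  Lspace_incl r1 rp x = Lspace_incl r1 rq (Lspace_incl q1 qp x).
Proof.
apply/Lspace_eqP; apply: ae_eq_trans (Lspace_incl_ae _ _ _) _.
apply: ae_eq_sym; apply: ae_eq_trans (Lspace_incl_ae _ _ _) _.
exact: Lspace_incl_ae.
Qed.

Theorem theorem4p2 (R : realType)
    (H : completeNormedModType R) (dot : {dot H for idfun})
    (dot_norm : forall x : H, dot x x = `|x| ^+ 2)
    (d : measure_display) (T : measurableType d)
    (mu : {finite_measure set T -> \bar R})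
    (p : \bar R) (p2 : (2%:E <= p)%E)
    (S : {linear H -> LspaceType mu (ge2_ge1 p2)}) (S_compact : compact_op S)
    (alpha : R) (alpha_gt0 : 0 < alpha) (alpha_lt2 : alpha < 2)
    (eS2 : seq_equiv
       (entropy_number (Lspace_incl (ge2_ge1 (lexx 2%:E)) p2 \o S))
       (fun n => n%:R `^ (- alpha^-1)))
    (q : \bar R) (q2 : (2%:E <= q)%E) (qp : (q <= p)%E) :
  seq_equiv (kolmogorov_number (Lspace_incl (ge2_ge1 q2) qp \o S))
    (fun n => n%:R `^ (- alpha^-1)) <->
  seq_equiv (entropy_number (Lspace_incl (ge2_ge1 q2) qp \o S))
    (fun n => n%:R `^ (- alpha^-1)).
Proof.
set v : {linear H -> LspaceType mu (ge2_ge1 q2)} := Lspace_incl _ qp \o S.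
have [c1 c10 Sc] := compact_op_bounded S_compact.
have [c2 c20 ic] := Lspace_incl_bounded mu (ge2_ge1 p2) (ge2_ge1 q2) qp.
have c0 : 0 < c2 * c1 by rewrite mulr_gt0.
have vc x : `|v x| <= c2 * c1 * `|x|.
  by apply: le_trans (ic _) _; rewrite -mulrA ler_pM2l.
have [C C0 wC] := Lspace_incl_bounded mu (ge2_ge1 q2) (ge2_ge1 (lexx 2%:E)) q2.
have e2 n := @entropy_number_comp R H _ _ v (Lspace_incl (ge2_ge1 (lexx 2%:E)) q2)
  (Lspace_incl (ge2_ge1 (lexx 2%:E)) p2 \o S) _ _ n c0 vc C0 wC
  (fun x => Lspace_incl_trans (ge2_ge1 q2) (ge2_ge1 (lexx 2%:E)) qp q2 p2 (S x)).
split=> [[[k k0 kP] _]|[[k k0 kP] [l l0 lP]]].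
  split; first exact: (entropy_from_kolmogorov c0 vc k0 alpha_gt0 kP).
  have [_ [l l0 lP]] := eS2; exists (l * C); first by rewrite mulr_gt0.
  move=> n n1; apply: le_trans (lP n n1) _.
  by rewrite -mulrA ler_pM2l.
have [k' k'0 k'P] := kolmogorov_from_entropy (inner_of_dot dot_norm) c0 vc k0
  alpha_gt0 alpha_lt2 kP.
split; first by exists k'.
(* The second half of the equivalence for e_n reads n^(-1/alpha) <= l e_n, whence the inverses of
   [l] and [m]. *)
have [||m m0 mP] := @kolmogorov_lower_bound _ _ _ v _ c0 vc k' l^-1 alpha k'0 _
  alpha_gt0 k'P.
- by rewrite invr_gt0.
- by move=> n n1; rewrite ler_pdivrMl // lP.
by exists m^-1; rewrite ?invr_gt0 // => n n1; rewrite -ler_pdivrMl ?invr_gt0 // invrK mP.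
Qed.
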